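(* Let $(H,R)$ be a quasitriangular quasi-bialgebra over a field $k$, with comultiplication $\Delta_H$, counit $\varepsilon_H$ and reassociator $\Phi$. Then the Laurent polynomial algebra $H[\theta,\theta^{-1}]$ is a balanced quasi-bialgebra (with reassociator $\Phi$ and $R$-matrix $R$ coming from $H$) with structure given by $$\Delta|_H=\Delta_H,\quad \Delta(\theta)=(R_{21}R)^{-1}(\theta\otimes\theta),\quad \Delta(\theta^{-1})=(R_{21}R)(\theta^{-1}\otimes\theta^{-1}),\quad \varepsilon|_H=\varepsilon_H,\quad \varepsilon(\theta)=\varepsilon(\theta^{-1})=1.$$
   Context: A quasi-bialgebra over $k$ is $(H,\Delta,\varepsilon,\Phi)$ with $H$ a unital associative $k$-algebra, $\Phi\in H\otimes H\otimes H$ invertible, and $\Delta:H\to H\otimes H$, $\varepsilon:H\to k$ algebra morphisms such that $(\mathrm{Id}\otimes\Delta)(\Delta(h))=\Phi(\Delta\otimes\mathrm{Id})(\Delta(h))\Phi^{-1}$, $(\mathrm{Id}\otimes\varepsilon)(\Delta(h))=h=(\varepsilon\otimes\mathrm{Id})(\Delta(h))$, $(1\otimes\Phi)(\mathrm{Id}\otimes\Delta\otimes\mathrm{Id})(\Phi)(\Phi\otimes1)=(\mathrm{Id}\otimes\mathrm{Id}\otimes\Delta)(\Phi)(\Delta\otimes\mathrm{Id}\otimes\mathrm{Id})(\Phi)$ and $(\mathrm{Id}\otimes\varepsilon\otimes\mathrm{Id})(\Phi)=1\otimes1$. Write $\Phi=X^1\otimes X^2\otimes X^3=Y^1\otimes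 Y^2\otimes Y^3$, $\Phi^{-1}=x^1\otimes x^2\otimes x^3=y^1\otimes y^2\otimes y^3$ (summation understood). $(H,R)$ is quasitriangular (QT) if $R=R^1\otimes R^2=r^1\otimes r^2\in H\otimes H$ is invertible and $(\Delta\otimes\mathrm{Id})(R)=X^2R^1x^1Y^1\otimes X^3x^3r^1Y^2\otimes X^1R^2x^2r^2Y^3$, $(\mathrm{Id}\otimes\Delta)(R)=x^3R^1X^2r^1y^1\otimes x^1X^1r^2y^2\otimes x^2R^2X^3y^3$, $\Delta^{\mathrm{cop}}(h)R=R\Delta(h)$ for all $h\in H$, where $\Delta^{\mathrm{cop}}$ is $\Delta$ followed by the flip. $R_{21}=R^2\otimes R^1$. A QT quasi-bialgebra $(H,R)$ is balanced if there is an invertible central element $\eta\in H$ with $\Delta(\eta)=(\eta\otimes\eta)R_{21}R$. $H[\theta,\theta^{-1}]$ is the $k$-algebra freely generated by the algebra $H$ and $\theta,\theta^{-1}$, with relations $h\theta=\theta h$ for all $h\in H$ and $\theta\theta^{-1}=\theta^{-1}\theta=1$. *)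

(* Defs.v *)
From HB Require Import structures.
From mathcomp Require Import all_boot all_order all_algebra.
From mathcomp Require Import generic_quotient.
From mathcomp Require Import boolp classical_sets.

Set Implicit Arguments.
Unset Strict Implicit.
Unset Printing Implicit Defensive.

Import GRing.Theory.
Local Open Scope ring_scope.
Local Open Scope quotient_scope.

Reserved Notation "x ⊗ y" (at level 45, right associativity).

(** * Tensor product of vector spaces, as formal sums of pure tensors modulo
    the congruence generated by bilinearity. *)
Section TensorRel.
Variables (k : fieldType) (A B : lmodType k).

(* The list [:: (a1, b1); ...; (an, bn)] stands for a1 ⊗ b1 + ... + an ⊗ bn. *)
Inductive tens_eq : seq (A * B) -> seq (A * B) -> Prop :=
| TensRefl s : tens_eq s s
| TensSym s t : tens_eq s t -> tens_eq t s
| TensTrans s t u : tens_eq s t -> tens_eq t u -> tens_eq s u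
| TensCat s s' t t' : tens_eq s s' -> tens_eq t t' -> tens_eq (s ++ t) (s' ++ t')
| TensComm s t : tens_eq (s ++ t) (t ++ s)
| Tens0 b : tens_eq [:: (0, b)] [::]
| TensDl a a' b : tens_eq [:: (a + a', b)] [:: (a, b); (a', b)]
| TensDr a b b' : tens_eq [:: (a, b + b')] [:: (a, b); (a, b')]
| TensZ c a b : tens_eq [:: (c *: a, b)] [:: (a, c *: b)].

Definition tens_eqb (s t : seq (A * B)) : bool := `[< tens_eq s t >].

Lemma tens_eqb_refl : reflexive tens_eqb.
Proof. by move=> s; apply/asboolP; exact: TensRefl. Qed.
Lemma tens_eqb_sym : symmetric tens_eqb.
Proof.
by move=> s t; apply/idP/idP => /asboolP H; apply/asboolP; exact: TensSym.
Qed.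
Lemma tens_eqb_trans : transitive tens_eqb.
Proof.
by move=> s t u /asboolP H /asboolP H'; apply/asboolP; exact: TensTrans H H'.
Qed.

Canonical tens_equiv := EquivRel tens_eqb tens_eqb_refl tens_eqb_sym tens_eqb_trans.

Definition tensor := {eq_quot tens_equiv}.
HB.instance Definition _ := EqQuotient.on tensor.
HB.instance Definition _ := Choice.on tensor.

Lemma tensor_eqP (s t : seq (A * B)) : tens_eq s t <-> \pi_tensor s = \pi_tensor t.
Proof.
split=> [H|/eqP]; first by apply/eqP; rewrite eqmodE; apply/asboolP.
by rewrite eqmodE => /asboolP.
Qed.

Definition ten (a : A) (b : B) : tensor := \pi_tensor [:: (a, b)].
End TensorRel.

Notation "A ⊗ B" := (tensor A%type B%type) : type_scope.
Notation "x ⊗ y" := (ten x y) : ring_scope.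

Section TensorLmod.
Variables (k : fieldType) (A B : lmodType k).
Local Notation T := (tensor A B).
Implicit Types (s : seq (A * B)) (t : T).

Definition tens_zero : T := \pi_T [::].
Definition tens_add : T -> T -> T :=
  locked (fun t u => \pi_T (repr t ++ repr u)).
Definition tens_scale : k -> T -> T :=
  locked (fun c t => \pi_T [seq (c *: p.1, p.2) | p <- repr t]).

Lemma tens_addE s s' : tens_add (\pi_T s) (\pi_T s') = \pi_T (s ++ s').
Proof.
by rewrite /tens_add -lock; apply/tensor_eqP; apply: TensCat; apply/tensor_eqP; rewrite reprK.
Qed.

Lemma tens_eq_map_scale c s s' : tens_eq s s' ->
  tens_eq [seq (c *: p.1, p.2) | p <- s] [seq (c *: p.1, p.2) | p <- s'].
Proof.
elim=> {s s'} [s|s t _ E|s t u _ E _ E'|s s' t t' _ E _ E'|s t|b|a a' b|a b b'|d a b] /=.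
- exact: TensRefl.
- exact: TensSym.
- exact: TensTrans E E'.
- by rewrite !map_cat; apply: TensCat.
- by rewrite !map_cat; apply: TensComm.
- by rewrite scaler0; apply: Tens0.
- by rewrite scalerDr; apply: TensDl.
- exact: TensDr.
- by rewrite scalerA mulrC -scalerA; apply: TensZ.
Qed.

Lemma tens_scaleE c s :
  tens_scale c (\pi_T s) = \pi_T [seq (c *: p.1, p.2) | p <- s].
Proof.
rewrite /tens_scale -lock.
by apply/tensor_eqP; apply: tens_eq_map_scale; apply/tensor_eqP; rewrite reprK.
Qed.

Lemma tens_addA : associative tens_add.
Proof.
by move=> s; elim/quotW: s => s; move=> t; elim/quotW: t => t; move=> u; elim/quotW: u => u; rewrite !tens_addE catA.
Qed.
Lemma tens_addC : commutative tens_add.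
Proof.
move=> s; elim/quotW: s => s; move=> t; elim/quotW: t => t; rewrite !tens_addE.
by apply/tensor_eqP; exact: TensComm.
Qed.
Lemma tens_add0 : left_id tens_zero tens_add.
Proof. by move=> s; elim/quotW: s => s; rewrite tens_addE. Qed.

Lemma tens_scaleDl t : {morph tens_scale^~ t : c d / c + d >-> tens_add c d}.
Proof.
move=> c d; elim/quotW: t => s; rewrite !tens_scaleE tens_addE.
apply/tensor_eqP; elim: s => [|[a b] s IH] /=; first exact: TensRefl.
rewrite -cat1s -[X in tens_eq _ X]cat1s scalerDl.
apply: (TensTrans (t := [:: (c *: a, b); (d *: a, b)] ++ _)).
  exact: TensCat (TensDl _ _ _) IH.
rewrite -cat1s -catA; apply: TensCat; first exact: TensRefl.
rewrite catA -[X in tens_eq _ (_ ++ X)]cat1s catA; apply: TensCat; last exact: TensRefl.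
exact: TensComm.
Qed.

Lemma tens_scale0 t : tens_scale 0 t = tens_zero.
Proof.
elim/quotW: t => s; rewrite tens_scaleE; apply/tensor_eqP.
elim: s => [|[a b] s IH] /=; first exact: TensRefl.
by rewrite scale0r -cat1s -[X in tens_eq _ X]cat0s; apply: TensCat IH; exact: Tens0.
Qed.

Lemma tens_scale1 : left_id 1 tens_scale.
Proof.
move=> s; elim/quotW: s => s; rewrite tens_scaleE; congr (\pi_T _).
by elim: s => //= -[a b] s ->; rewrite scale1r.
Qed.

Lemma tens_addN : left_inverse tens_zero (tens_scale (-1)) tens_add.
Proof. by move=> t; rewrite -{2}[t]tens_scale1 -tens_scaleDl addNr tens_scale0. Qed.

HB.instance Definition _ :=
  GRing.isZmodule.Build T tens_addA tens_addC tens_add0 tens_addN.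

Lemma tens_scaleA c d t : tens_scale c (tens_scale d t) = tens_scale (c * d) t.
Proof.
elim/quotW: t => s; rewrite !tens_scaleE -map_comp; congr (\pi_T _).
by apply: eq_map => p /=; rewrite scalerA.
Qed.
Lemma tens_scaleDr : right_distributive tens_scale +%R.
Proof.
move=> c s; elim/quotW: s => s; move=> t; elim/quotW: t => t.
by rewrite /GRing.add /= !tens_scaleE !tens_addE tens_scaleE map_cat.
Qed.

HB.instance Definition _ := GRing.Zmodule_isLmodule.Build k T
  tens_scaleA tens_scale1 tens_scaleDr tens_scaleDl.

Lemma tenDl a a' b : (a + a') ⊗ b = a ⊗ b + a' ⊗ b :> T.
Proof. by rewrite [RHS]tens_addE; apply/tensor_eqP; exact: TensDl. Qed.
Lemma tenDr a b b' : a ⊗ (b + b') = a ⊗ b + a ⊗ b' :> T.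
Proof. by rewrite [RHS]tens_addE; apply/tensor_eqP; exact: TensDr. Qed.
Lemma tenZl c a b : (c *: a) ⊗ b = c *: (a ⊗ b) :> T.
Proof. by rewrite [RHS]tens_scaleE. Qed.
Lemma tenZr c a b : a ⊗ (c *: b) = c *: (a ⊗ b) :> T.
Proof. by rewrite -tenZl; apply/tensor_eqP; apply: TensSym; exact: TensZ. Qed.

Lemma ten_bilinear : bilinear_for *:%R *:%R (@ten k A B).
Proof.
by split=> u c x y; rewrite ?tenDl ?tenDr ?tenZl ?tenZr.
Qed.

Lemma tensor_piE s : \pi_T s = \sum_(p <- s) (p.1 ⊗ p.2).
Proof.
elim: s => [|[a b] s IH]; first by rewrite big_nil.
by rewrite big_cons -IH [RHS]tens_addE.
Qed.

Lemma tensor_reprE t : t = \sum_(p <- repr t) (p.1 ⊗ p.2).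
Proof. by rewrite -tensor_piE reprK. Qed.

Lemma tensor_ind (P : T -> Prop) : (forall a b, P (a ⊗ b)) ->
  (forall t u, P t -> P u -> P (t + u)) -> forall t, P t.
Proof.
move=> Pten PD t; rewrite (tensor_reprE t).
elim: (repr t) => [|p s IH]; last by rewrite big_cons; apply: PD.
by rewrite big_nil -(scale0r (0 ⊗ 0)) -tenZl.
Qed.
End TensorLmod.

(** * Summation over the pure tensors of an element (sumless notation).
    [tlift f t] applies [f] to a chosen decomposition of [t] into pure tensors;
    for bilinear [f] it does not depend on the choice and is the linear map
    induced by [f] (lemmas [tliftE] and [tlift_linear]). *)
Section TensorLift.
Variables (k : fieldType) (A B W : lmodType k).

Definition tlift (f : A -> B -> W) (t : A ⊗ B) : W :=
  \sum_(p <- repr t) f p.1 p.2.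

Variable f : A -> B -> W.
Hypothesis fbil : bilinear_for *:%R *:%R f.

Let fDl a a' b : f (a + a') b = f a b + f a' b.
Proof. by have := fbil.1 b 1 a a'; rewrite /= !scale1r. Qed.
Let fDr a b b' : f a (b + b') = f a b + f a b'.
Proof. by have := fbil.2 a 1 b b'; rewrite /= !scale1r. Qed.
Let f0l b : f 0 b = 0.
Proof. by apply: (addIr (f 0 b)); rewrite -fDl !add0r. Qed.
Let f0r a : f a 0 = 0.
Proof. by apply: (addIr (f a 0)); rewrite -fDr !add0r. Qed.
Let fZl c a b : f (c *: a) b = c *: f a b.
Proof. by have := fbil.1 b c a 0; rewrite /= f0l !addr0. Qed.
Let fZr c a b : f a (c *: b) = c *: f a b.
Proof. by have := fbil.2 a c b 0; rewrite /= f0r !addr0. Qed.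

Lemma tlift_pi (s : seq (A * B)) :
  tlift f (\pi_(A ⊗ B)%type s) = \sum_(p <- s) f p.1 p.2.
Proof.
have : tens_eq (repr (\pi_(A ⊗ B)%type s)) s by apply/tensor_eqP; rewrite reprK.
rewrite /tlift; move: (repr _) => s'.
elim=> {s s'} [s|s t _ ?|s t u _ ? _ H|s s' t t' _ E _ E'|s t|b|a a' b|a b b'|d a b] //=.
- by rewrite -H.
- by rewrite !big_cat /= E E'.
- by rewrite !big_cat /= addrC.
- by rewrite big_seq1 big_nil.
- by rewrite !big_cons big_nil /= fDl !addr0.
- by rewrite !big_cons big_nil /= fDr !addr0.
- by rewrite !big_seq1 /= fZl fZr.
Qed.

Lemma tliftE a b : tlift f (a ⊗ b) = f a b.
Proof. by rewrite tlift_pi big_seq1. Qed.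

Lemma tlift_linear : linear (tlift f).
Proof.
move=> c s; elim/quotW: s => s; move=> t; elim/quotW: t => t.
rewrite [c *: _]tens_scaleE [_ + _]tens_addE !tlift_pi big_cat big_map /=.
by rewrite scaler_sumr; congr (_ + _); apply: eq_bigr => p _; rewrite fZl.
Qed.
End TensorLift.

Definition tlift3 (k : fieldType) (A B C W : lmodType k) (f : A -> B -> C -> W)
  (t : A ⊗ (B ⊗ C)) : W := tlift (fun a => tlift (f a)) t.

Notation "\sw_ ( a , b <- t ) E" := (tlift (fun a b => E) t)
  (at level 36, E at level 46, a name, b name, t at level 50,
   format "'[' \sw_ ( a ,  b  <-  t ) '/  '  E ']'") : ring_scope.
Notation "\sw_ ( a , b , c <- t ) E" := (tlift3 (fun a b c => E) t)
  (at level 36, E at level 46, a name, b name, c name, t at level 50,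
   format "'[' \sw_ ( a ,  b ,  c  <-  t ) '/  '  E ']'") : ring_scope.

Local Open Scope classical_set_scope.
(* A linear form that does not kill 1; it shows that 1 ⊗ 1 <> 0. *)
Lemma unit_form (k : fieldType) (A : algType k) :
  exists f : A -> k^o, linear f /\ f 1 = 1.
Proof.
pose sub (U : set A) := forall c x y, U x -> U y -> U (c *: x + y).
have [|U [[subU U1] Umax]] := @Zorn_bigcup A [set U | sub U /\ ~ U 1].
  move=> F FP Ftot; split; last by case=> U /FP[_ +]; apply.
  move=> c x y [U FU Ux] [V FV Vy].
  have [UV|VU] := Ftot _ _ FU FV.
    by exists V => //; apply: (FP _ FV).1 => //; apply: UV.
  by exists U => //; apply: (FP _ FU).1 => //; apply: VU.
have U0 : U 0.
  apply: contrapT => U0.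
  refine (Umax [set 0] _ _); last first.
    split=> [c x y -> ->|]; first by rewrite /= scaler0 addr0.
    by move/eqP; rewrite oner_eq0.
  split=> [x Ux|/(_ 0 erefl)//]; case: U0.
  by have := subU (-1) x x Ux Ux; rewrite scaleN1r addNr.
have UZ c x : U x -> U (c *: x) by move=> Ux; rewrite -[_ *: _]addr0; apply: subU.
have dec x : exists c, U (x - c *: 1).
  have [Ux|nUx] := pselect (U x); first by exists 0; rewrite scale0r subr0.
  pose V := [set y | exists c, U (y - c *: x)].
  have UV : U `<=` V by move=> y Uy; exists 0; rewrite scale0r subr0.
  have Vx : V x by exists 1; rewrite scale1r subrr.
  have : V 1.
    apply: contrapT => nV1; refine (Umax V _ _).
      by split=> // /(_ x Vx).
    split=> // c y z [d Ud] [e Ue]; exists (c * d + e).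
    have -> : c *: y + z - (c * d + e) *: x = c *: (y - d *: x) + (z - e *: x).
      by rewrite scalerBr scalerA scalerDl opprD addrACA.
    exact: subU.
  move=> [c Uc]; exists c^-1.
  have c0 : c != 0.
    by apply/eqP => c0; apply: U1; move: Uc; rewrite c0 scale0r subr0.
  have -> : x - c^-1 *: 1 = - c^-1 *: (1 - c *: x).
    by rewrite scalerBr scalerA mulNr mulVf // !scaleNr scale1r opprK addrC.
  exact: UZ.
have uniq x c d : U (x - c *: 1) -> U (x - d *: 1) -> c = d.
  move=> Uc Ud; apply/eqP; rewrite -subr_eq0; apply/eqP; apply: contrapT => /eqP cd0.
  apply: U1; have := UZ (c - d)^-1 _ (subU (-1) _ _ Uc Ud).
  have -> : -1 *: (x - c *: 1) + (x - d *: 1) = (c - d) *: 1 :> A.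
    by rewrite scaleN1r opprB addrA subrK -scalerBl.
  by rewrite scalerA mulVf // scale1r.
pose f x := projT1 (cid (dec x)); have fP x : U (x - f x *: 1) := projT2 (cid (dec x)).
exists f; split=> [c x y|].
  apply: (uniq _ _ _ (fP _)).
  have -> : c *: x + y - (c *: (f x : k^o) + f y : k) *: 1
    = c *: (x - f x *: 1) + (y - f y *: 1).
    by rewrite scalerDl scalerBr opprD addrACA scalerA.
  exact: subU.
by apply: (uniq _ _ _ (fP _)); rewrite scale1r subrr.
Qed.
Local Close Scope classical_set_scope.

Section TensorAlg.
Variables (k : fieldType) (A B : algType k).
Local Notation T := (A ⊗ B)%type.

Definition tens_one : T := 1 ⊗ 1.
Definition tens_mul (t u : T) : T :=
  \sw_(a, b <- t) \sw_(a', b' <- u) (a * a' ⊗ b * b').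

Let mul1_bil a b : bilinear_for *:%R *:%R (fun a' b' => a * a' ⊗ b * b' : T).
Proof.
split=> u c x y /=.
  by rewrite mulrDr -scalerAr tenDl tenZl.
by rewrite mulrDr -scalerAr tenDr tenZr.
Qed.

Let mul2_bil (u : T) :
  bilinear_for *:%R *:%R (fun a b => \sw_(a', b' <- u) (a * a' ⊗ b * b') : T).
Proof.
split=> v c x y; rewrite /tlift /= scaler_sumr -big_split; apply: eq_bigr => p _ /=.
  by rewrite mulrDl -scalerAl tenDl tenZl.
by rewrite mulrDl -scalerAl tenDr tenZr.
Qed.

Lemma tens_mulE a b a' b' : tens_mul (a ⊗ b) (a' ⊗ b') = a * a' ⊗ b * b'.
Proof. by rewrite /tens_mul tliftE // tliftE. Qed.

Lemma tens_mulDl : left_distributive tens_mul +%R.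
Proof.
move=> t u v; have := tlift_linear (mul2_bil v) 1 t u.
by rewrite !scale1r.
Qed.

Let tens_mul0 u : tens_mul 0 u = 0.
Proof. by apply: (addIr (tens_mul 0 u)); rewrite -tens_mulDl !add0r. Qed.

Lemma tens_scaleAl c t u : c *: tens_mul t u = tens_mul (c *: t) u.
Proof.
have := tlift_linear (mul2_bil u) c t 0; rewrite addr0 -/(tens_mul _ _) => ->.
by rewrite -/(tens_mul 0 u) tens_mul0 addr0.
Qed.

Let tens_mul_lin t : linear (tens_mul t).
Proof.
move=> c u v; rewrite /tens_mul {1 3 5}/tlift scaler_sumr -big_split.
by apply: eq_bigr => p _; rewrite /= (tlift_linear (mul1_bil _ _)).
Qed.

Lemma tens_mulDr : right_distributive tens_mul +%R.
Proof. by move=> t u v; have := tens_mul_lin t 1 u v; rewrite !scale1r. Qed.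

Let tens_mulr0 t : tens_mul t 0 = 0.
Proof. by apply: (addIr (tens_mul t 0)); rewrite -tens_mulDr !add0r. Qed.

Lemma tens_scaleAr c t u : c *: tens_mul t u = tens_mul t (c *: u).
Proof. by have := tens_mul_lin t c u 0; rewrite tens_mulr0 !addr0. Qed.

Lemma tens_mulA : associative tens_mul.
Proof.
move=> t u v.
elim/tensor_ind: t => [a b|t t' IH IH']; last by rewrite !tens_mulDl IH IH'.
elim/tensor_ind: u => [a' b'|t t' IH IH']; last by rewrite !(tens_mulDl, tens_mulDr) IH IH'.
elim/tensor_ind: v => [c d|t t' IH IH']; last by rewrite !tens_mulDr IH IH'.
by rewrite !tens_mulE !mulrA.
Qed.
Lemma tens_mul1 : left_id tens_one tens_mul.
Proof.
by elim/tensor_ind=> [a b|t u IH IH']; rewrite ?tens_mulE ?mul1r // tens_mulDr IH IH'.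
Qed.
Lemma tens_mulr1 : right_id tens_one tens_mul.
Proof.
by elim/tensor_ind=> [a b|t u IH IH']; rewrite ?tens_mulE ?mulr1 // tens_mulDl IH IH'.
Qed.

Lemma tens_one_neq0 : tens_one != 0.
Proof.
have [f [flin f1]] := unit_form A; have [g [glin g1]] := unit_form B.
pose h (a : A) (b : B) : k^o := (f a : k) * g b.
have hbil : bilinear_for *:%R *:%R h.
  split=> u c x y; rewrite /h.
    by rewrite flin mulrDl -mulrA.
  by rewrite glin mulrDr mulrCA.
apply/eqP => E; have := tliftE hbil 1 1; rewrite -/tens_one E.
have -> : tlift h 0 = 0.
  by have := tlift_linear hbil (-1) 0 0; rewrite scaleN1r addNr scaleN1r addNr.
by rewrite /h f1 g1 mulr1 => /esym/eqP; rewrite oner_eq0.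
Qed.

HB.instance Definition _ := GRing.Zmodule_isNzRing.Build T
  tens_mulA tens_mul1 tens_mulr1 tens_mulDl tens_mulDr tens_one_neq0.
HB.instance Definition _ := GRing.Lmodule_isLalgebra.Build k T tens_scaleAl.
HB.instance Definition _ := GRing.Lalgebra_isAlgebra.Build k T tens_scaleAr.

Lemma tenM a b a' b' : (a ⊗ b) * (a' ⊗ b') = a * a' ⊗ b * b' :> T.
Proof. exact: tens_mulE. Qed.
Lemma ten1 : 1 = 1 ⊗ 1 :> T.
Proof. by []. Qed.
End TensorAlg.

Definition invertible (A : nzRingType) (x : A) := exists y, x * y = 1 /\ y * x = 1.

(* Units and inverses in tensor product algebras, by classical choice. *)
Section TensorUnit.
Variables (k : fieldType) (A B : algType k).
Local Notation T := (A ⊗ B)%type.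

Definition tens_unit : pred T := fun t => `[< invertible t >].
Definition tens_inv (t : T) : T :=
  if pselect (invertible t) is left h then projT1 (cid h) else t.

Lemma tens_mulV : {in tens_unit, left_inverse 1 tens_inv *%R}.
Proof.
move=> t /asboolP it; rewrite /tens_inv; case: pselect => // h.
by have [_ ->] := projT2 (cid h).
Qed.
Lemma tens_divrr : {in tens_unit, right_inverse 1 tens_inv *%R}.
Proof.
move=> t /asboolP it; rewrite /tens_inv; case: pselect => // h.
by have [-> _] := projT2 (cid h).
Qed.
Lemma tens_unitP t u : u * t = 1 /\ t * u = 1 -> tens_unit t.
Proof. by move=> [ut tu]; apply/asboolP; exists u. Qed.
Lemma tens_inv_out : {in [predC tens_unit], tens_inv =1 id}.
Proof.
move=> t /negP nt; rewrite /tens_inv; case: pselect => // h.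
by case: nt; apply/asboolP.
Qed.

HB.instance Definition _ := GRing.NzRing_hasMulInverse.Build T
  tens_mulV tens_divrr tens_unitP tens_inv_out.

Lemma tens_unitE (t : T) : (t \is a GRing.unit) <-> invertible t.
Proof. by split => /asboolP. Qed.
End TensorUnit.

(** * Quasi-bialgebras.  Iterated tensor products are associated to the right;
    the canonical isomorphisms (U ⊗ V) ⊗ W = U ⊗ (V ⊗ W) and U ⊗ k = U = k ⊗ U
    are applied implicitly. *)
Section QuasiBialgebra.
Variables (k : fieldType) (H : algType k).

Definition tflip (t : H ⊗ H) : H ⊗ H := \sw_(a, b <- t) (b ⊗ a).

Record quasiBialgebra := QuasiBialgebra {
  comul : {lrmorphism H -> H ⊗ H};
  counit : {lrmorphism H -> k^o};
  reassoc : H ⊗ H ⊗ H;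
  reassoc_unit : reassoc \is a GRing.unit;
  comul_coassoc : forall h : H,
    \sw_(a, b <- comul h) (a ⊗ comul b) =
    reassoc * (\sw_(a, b <- comul h) \sw_(a1, a2 <- comul a) (a1 ⊗ a2 ⊗ b))
      * reassoc^-1;
  counitr : forall h : H, \sw_(a, b <- comul h) ((counit b : k) *: a) = h;
  counitl : forall h : H, \sw_(a, b <- comul h) ((counit a : k) *: b) = h;
  reassoc_pentagon :
    (1 ⊗ reassoc)
      * (\sw_(a, b, c <- reassoc) \sw_(b1, b2 <- comul b) (a ⊗ b1 ⊗ b2 ⊗ c))
      * (\sw_(a, b, c <- reassoc) (a ⊗ b ⊗ c ⊗ 1)) =
    (\sw_(a, b, c <- reassoc) (a ⊗ b ⊗ comul c))
      * (\sw_(a, b, c <- reassoc) \sw_(a1, a2 <- comul a) (a1 ⊗ a2 ⊗ b ⊗ c))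
    :> (H ⊗ H ⊗ H ⊗ H)%type;
  reassoc_counit : \sw_(a, b, c <- reassoc) ((counit b : k) *: (a ⊗ c))
    = 1 ⊗ 1
}.

Record quasitriangular (Q : quasiBialgebra) := Quasitriangular {
  rmx : H ⊗ H;
  rmx_unit : rmx \is a GRing.unit;
  rmx_comull :
    \sw_(a, b <- rmx) \sw_(a1, a2 <- comul Q a) (a1 ⊗ a2 ⊗ b) =
    \sw_(X1, X2, X3 <- reassoc Q) \sw_(R1, R2 <- rmx)
    \sw_(x1, x2, x3 <- (reassoc Q)^-1) \sw_(r1, r2 <- rmx)
    \sw_(Y1, Y2, Y3 <- reassoc Q)
      (X2 * R1 * x1 * Y1 ⊗ X3 * x3 * r1 * Y2 ⊗ X1 * R2 * x2 * r2 * Y3);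
  rmx_comulr :
    \sw_(a, b <- rmx) (a ⊗ comul Q b) =
    \sw_(x1, x2, x3 <- (reassoc Q)^-1) \sw_(R1, R2 <- rmx)
    \sw_(X1, X2, X3 <- reassoc Q) \sw_(r1, r2 <- rmx)
    \sw_(y1, y2, y3 <- (reassoc Q)^-1)
      (x3 * R1 * X2 * r1 * y1 ⊗ x1 * X1 * r2 * y2 ⊗ x2 * R2 * X3 * y3);
  rmx_comm : forall h : H, tflip (comul Q h) * rmx = rmx * comul Q h
}.

Definition balanced (Q : quasiBialgebra) (R : quasitriangular Q) : Prop :=
  exists eta : H, [/\ invertible eta, forall h, eta * h = h * eta
    & comul Q eta = (eta ⊗ eta) * (tflip (rmx R) * rmx R)].
End QuasiBialgebra.

(** * The algebra H[θ, θ^-1], presented by generators and relations: terms in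
    the elements of H, θ and θ^-1, modulo the congruence generated by the
    algebra axioms, the algebra structure of H and the relations on θ. *)
Section Laurent.
Variables (k : fieldType) (H : algType k).

Inductive lterm : Type :=
| LGen of H | LTheta | LThetaV
| LAdd of lterm & lterm | LMul of lterm & lterm | LScale of k & lterm.

HB.instance Definition _ := gen_eqMixin lterm.
HB.instance Definition _ := gen_choiceMixin lterm.

Inductive lrel : lterm -> lterm -> Prop :=
| LRefl x : lrel x x
| LSym x y : lrel x y -> lrel y x
| LTrans x y z : lrel x y -> lrel y z -> lrel x z
| LAddCongr x x' y y' : lrel x x' -> lrel y y' -> lrel (LAdd x y) (LAdd x' y')
| LMulCongr x x' y y' : lrel x x' -> lrel y y' -> lrel (LMul x y) (LMul x' y')
| LScaleCongr c x x' : lrel x x' -> lrel (LScale c x) (LScale c x')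
| LAddA x y z : lrel (LAdd x (LAdd y z)) (LAdd (LAdd x y) z)
| LAddC x y : lrel (LAdd x y) (LAdd y x)
| LAdd0 x : lrel (LAdd (LGen 0) x) x
| LAddN x : lrel (LAdd (LScale (-1) x) x) (LGen 0)
| LMulA x y z : lrel (LMul x (LMul y z)) (LMul (LMul x y) z)
| LMul1 x : lrel (LMul (LGen 1) x) x
| LMulr1 x : lrel (LMul x (LGen 1)) x
| LMulDl x y z : lrel (LMul (LAdd x y) z) (LAdd (LMul x z) (LMul y z))
| LMulDr x y z : lrel (LMul x (LAdd y z)) (LAdd (LMul x y) (LMul x z))
| LScaleA c d x : lrel (LScale c (LScale d x)) (LScale (c * d) x)
| LScale1 x : lrel (LScale 1 x) x
| LScaleDr c x y : lrel (LScale c (LAdd x y)) (LAdd (LScale c x) (LScale c y))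
| LScaleDl c d x : lrel (LScale (c + d) x) (LAdd (LScale c x) (LScale d x))
| LScaleAl c x y : lrel (LScale c (LMul x y)) (LMul (LScale c x) y)
| LScaleAr c x y : lrel (LScale c (LMul x y)) (LMul x (LScale c y))
| LGenD g h : lrel (LGen (g + h)) (LAdd (LGen g) (LGen h))
| LGenM g h : lrel (LGen (g * h)) (LMul (LGen g) (LGen h))
| LGenZ c h : lrel (LGen (c *: h)) (LScale c (LGen h))
| LThetaC h : lrel (LMul (LGen h) LTheta) (LMul LTheta (LGen h))
| LThetaK : lrel (LMul LTheta LThetaV) (LGen 1)
| LThetaVK : lrel (LMul LThetaV LTheta) (LGen 1).

Definition lrelb (x y : lterm) : bool := `[< lrel x y >].

Lemma lrelb_refl : reflexive lrelb.
Proof. by move=> s; apply/asboolP; exact: LRefl. Qed.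
Lemma lrelb_sym : symmetric lrelb.
Proof.
by move=> s t; apply/idP/idP => /asboolP E; apply/asboolP; exact: LSym.
Qed.
Lemma lrelb_trans : transitive lrelb.
Proof.
by move=> s t u /asboolP E /asboolP E'; apply/asboolP; exact: LTrans E E'.
Qed.

Canonical lrel_equiv := EquivRel lrelb lrelb_refl lrelb_sym lrelb_trans.

Definition laurent := {eq_quot lrel_equiv}.
HB.instance Definition _ := EqQuotient.on laurent.
HB.instance Definition _ := Choice.on laurent.
Local Notation L := laurent.

Lemma laurent_eqP (x y : lterm) : lrel x y <-> \pi_L x = \pi_L y.
Proof.
split=> [E|/eqP]; first by apply/eqP; rewrite eqmodE; apply/asboolP.
by rewrite eqmodE => /asboolP.
Qed.

Definition lgen (h : H) : L := \pi_L (LGen h).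
Definition ltheta : L := \pi_L LTheta.
Definition lthetaV : L := \pi_L LThetaV.
Definition laurent_add : L -> L -> L :=
  locked (fun x y => \pi_L (LAdd (repr x) (repr y))).
Definition laurent_mul : L -> L -> L :=
  locked (fun x y => \pi_L (LMul (repr x) (repr y))).
Definition laurent_scale : k -> L -> L :=
  locked (fun c x => \pi_L (LScale c (repr x))).

Let lrepr (x : lterm) : lrel (repr (\pi_L x)) x.
Proof. by apply/laurent_eqP; rewrite reprK. Qed.

Lemma laurent_addE x y : laurent_add (\pi_L x) (\pi_L y) = \pi_L (LAdd x y).
Proof. by rewrite /laurent_add -lock; apply/laurent_eqP; apply: LAddCongr. Qed.
Lemma laurent_mulE x y : laurent_mul (\pi_L x) (\pi_L y) = \pi_L (LMul x y).
Proof. by rewrite /laurent_mul -lock; apply/laurent_eqP; apply: LMulCongr. Qed.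
Lemma laurent_scaleE c x : laurent_scale c (\pi_L x) = \pi_L (LScale c x).
Proof. by rewrite /laurent_scale -lock; apply/laurent_eqP; apply: LScaleCongr. Qed.
Let lE := (laurent_addE, laurent_mulE, laurent_scaleE).

Lemma laurent_addA : associative laurent_add.
Proof.
move=> x; elim/quotW: x => x; move=> y; elim/quotW: y => y; move=> z; elim/quotW: z => z; rewrite !lE.
by apply/laurent_eqP; exact: LAddA.
Qed.
Lemma laurent_addC : commutative laurent_add.
Proof.
by move=> x; elim/quotW: x => x; move=> y; elim/quotW: y => y; rewrite !lE; apply/laurent_eqP; exact: LAddC.
Qed.
Lemma laurent_add0 : left_id (lgen 0) laurent_add.
Proof. by move=> x; elim/quotW: x => x; rewrite !lE; apply/laurent_eqP; exact: LAdd0. Qed.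
Lemma laurent_addN : left_inverse (lgen 0) (laurent_scale (-1)) laurent_add.
Proof. by move=> x; elim/quotW: x => x; rewrite !lE; apply/laurent_eqP; exact: LAddN. Qed.

HB.instance Definition _ :=
  GRing.isZmodule.Build L laurent_addA laurent_addC laurent_add0 laurent_addN.

Let aE x y : \pi_L x + \pi_L y = \pi_L (LAdd x y).
Proof. exact: laurent_addE. Qed.

Lemma laurent_scaleA c d x :
  laurent_scale c (laurent_scale d x) = laurent_scale (c * d) x.
Proof. by elim/quotW: x => x; rewrite !lE; apply/laurent_eqP; exact: LScaleA. Qed.
Lemma laurent_scale1 : left_id 1 laurent_scale.
Proof. by move=> x; elim/quotW: x => x; rewrite !lE; apply/laurent_eqP; exact: LScale1. Qed.
Lemma laurent_scaleDr : right_distributive laurent_scale +%R.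
Proof.
move=> c; move=> x; elim/quotW: x => x; move=> y; elim/quotW: y => y; rewrite !(lE, aE).
by apply/laurent_eqP; exact: LScaleDr.
Qed.
Lemma laurent_scaleDl x : {morph laurent_scale^~ x : c d / c + d}.
Proof.
move=> c d; elim/quotW: x => x; rewrite !(lE, aE).
by apply/laurent_eqP; exact: LScaleDl.
Qed.

HB.instance Definition _ := GRing.Zmodule_isLmodule.Build k L
  laurent_scaleA laurent_scale1 laurent_scaleDr laurent_scaleDl.

Lemma laurent_mulA : associative laurent_mul.
Proof.
move=> x; elim/quotW: x => x; move=> y; elim/quotW: y => y; move=> z; elim/quotW: z => z; rewrite !lE.
by apply/laurent_eqP; exact: LMulA.
Qed.
Lemma laurent_mul1 : left_id (lgen 1) laurent_mul.
Proof. by move=> x; elim/quotW: x => x; rewrite !lE; apply/laurent_eqP; exact: LMul1. Qed.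
Lemma laurent_mulr1 : right_id (lgen 1) laurent_mul.
Proof. by move=> x; elim/quotW: x => x; rewrite !lE; apply/laurent_eqP; exact: LMulr1. Qed.
Lemma laurent_mulDl : left_distributive laurent_mul +%R.
Proof.
move=> x; elim/quotW: x => x; move=> y; elim/quotW: y => y; move=> z; elim/quotW: z => z; rewrite !(lE, aE).
by apply/laurent_eqP; exact: LMulDl.
Qed.
Lemma laurent_mulDr : right_distributive laurent_mul +%R.
Proof.
move=> x; elim/quotW: x => x; move=> y; elim/quotW: y => y; move=> z; elim/quotW: z => z; rewrite !(lE, aE).
by apply/laurent_eqP; exact: LMulDr.
Qed.

Section Eval.
Variables (B : algType k) (f : {lrmorphism H -> B}) (t tV : B).
Hypotheses (ftC : forall h, f h * t = t * f h) (tK : t * tV = 1) (tVK : tV * t = 1).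

Fixpoint leval (x : lterm) : B :=
  match x with
  | LGen h => f h
  | LTheta => t
  | LThetaV => tV
  | LAdd x y => leval x + leval y
  | LMul x y => leval x * leval y
  | LScale c x => c *: leval x
  end.

Lemma leval_rel x y : lrel x y -> leval x = leval y.
Proof.
elim=> {x y} //=.
- by move=> x y z _ -> _ ->.
- by move=> x x' y y' _ -> _ ->.
- by move=> x x' y y' _ -> _ ->.
- by move=> c x x' _ ->.
- by move=> *; rewrite addrA.
- by move=> *; rewrite addrC.
- by move=> *; rewrite rmorph0 add0r.
- by move=> *; rewrite scaleN1r addNr rmorph0.
- by move=> *; rewrite mulrA.
- by move=> *; rewrite rmorph1 mul1r.
- by move=> *; rewrite rmorph1 mulr1.
- by move=> *; rewrite mulrDl.
- by move=> *; rewrite mulrDr.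
- by move=> *; rewrite scalerA.
- by move=> *; rewrite scale1r.
- by move=> *; rewrite scalerDr.
- by move=> *; rewrite scalerDl.
- by move=> *; rewrite scalerAl.
- by move=> *; rewrite scalerAr.
- by move=> *; rewrite rmorphD.
- by move=> *; rewrite rmorphM.
- by move=> *; rewrite linearZ.
- by rewrite rmorph1.
- by rewrite rmorph1.
Qed.

Definition laurent_eval (x : L) : B := leval (repr x).

Lemma laurent_evalE x : laurent_eval (\pi_L x) = leval x.
Proof. exact: leval_rel (lrepr x). Qed.
End Eval.

Lemma laurent_one_neq0 : lgen 1 != 0.
Proof.
apply/eqP => E.
have comm1 (h : H) : idfun h * 1 = 1 * idfun h by rewrite mulr1 mul1r.
have ev := @laurent_evalE H idfun 1 1 comm1 (mulr1 1) (mulr1 1).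
have := ev (LGen 1); rewrite -/(lgen 1) E -[0]/(\pi_L (LGen 0)) ev /=.
by move/esym/eqP; rewrite oner_eq0.
Qed.

HB.instance Definition _ := GRing.Zmodule_isNzRing.Build L
  laurent_mulA laurent_mul1 laurent_mulr1 laurent_mulDl laurent_mulDr
  laurent_one_neq0.

Let mE x y : \pi_L x * \pi_L y = \pi_L (LMul x y).
Proof. exact: laurent_mulE. Qed.
Let sE c x : c *: \pi_L x = \pi_L (LScale c x).
Proof. exact: laurent_scaleE. Qed.

Lemma laurent_scaleAl c (x y : L) : c *: (x * y) = (c *: x) * y.
Proof.
elim/quotW: x => x; elim/quotW: y => y; rewrite !(mE, sE).
by apply/laurent_eqP; exact: LScaleAl.
Qed.
HB.instance Definition _ := GRing.Lmodule_isLalgebra.Build k L laurent_scaleAl.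
Lemma laurent_scaleAr c (x y : L) : c *: (x * y) = x * (c *: y).
Proof.
elim/quotW: x => x; elim/quotW: y => y; rewrite !(mE, sE).
by apply/laurent_eqP; exact: LScaleAr.
Qed.
HB.instance Definition _ := GRing.Lalgebra_isAlgebra.Build k L laurent_scaleAr.

Lemma lgen_linear : linear lgen.
Proof.
move=> c x y; rewrite sE aE; apply/laurent_eqP.
by apply: LTrans (LGenD _ _) _; apply: LAddCongr (LRefl _); exact: LGenZ.
Qed.
Lemma lgen_monoid_morphism : monoid_morphism lgen.
Proof. by split=> // x y; rewrite mE; apply/laurent_eqP; exact: LGenM. Qed.
HB.instance Definition _ := GRing.isLinear.Build k H L *:%R lgen lgen_linear.
HB.instance Definition _ := GRing.isMonoidMorphism.Build H L lgen lgen_monoid_morphism.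

Lemma lgen_thetaC h : lgen h * ltheta = ltheta * lgen h.
Proof. by rewrite !mE; apply/laurent_eqP; exact: LThetaC. Qed.
Lemma lthetaK : ltheta * lthetaV = 1.
Proof. by rewrite !mE; apply/laurent_eqP; exact: LThetaK. Qed.
Lemma lthetaVK : lthetaV * ltheta = 1.
Proof. by rewrite !mE; apply/laurent_eqP; exact: LThetaVK. Qed.

Lemma laurent_ind (P : L -> Prop) :
  (forall h, P (lgen h)) -> P ltheta -> P lthetaV ->
  (forall x y, P x -> P y -> P (x + y)) ->
  (forall x y, P x -> P y -> P (x * y)) ->
  (forall c x, P x -> P (c *: x)) -> forall x, P x.
Proof.
move=> Pg Pt PtV PD PM PZ x; elim/quotW: x.
by elim=> // [x Px y Py|x Px y Py|c x Px]; rewrite -?(aE, mE, sE); auto.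
Qed.

Lemma laurent_universal (B : algType k) (f : {lrmorphism H -> B}) (t tV : B) :
  (forall h, f h * t = t * f h) -> t * tV = 1 -> tV * t = 1 ->
  exists F : {lrmorphism L -> B},
    [/\ forall h, F (lgen h) = f h, F ltheta = t & F lthetaV = tV].
Proof.
move=> ftC tK tVK; pose F := laurent_eval f t tV.
have FE x : F (\pi_L x) = leval f t tV x by exact: laurent_evalE.
have Flin : linear F.
  by move=> c; move=> x; elim/quotW: x => x; move=> y; elim/quotW: y => y; rewrite sE aE !FE.
have Fmul : monoid_morphism F.
  split; first by rewrite -[1]/(lgen 1) FE /= rmorph1.
  by move=> x; elim/quotW: x => x; move=> y; elim/quotW: y => y; rewrite mE !FE.
pose F1 := GRing.isLinear.Build k L B *:%R F Flin.
pose F2 := GRing.isMonoidMorphism.Build L B F Fmul.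
pose G : {lrmorphism L -> B} := HB.pack F F1 F2.
by exists G; split=> [h||]; exact: FE.
Qed.

Lemma laurent_lrmorphism_eq (B : algType k) (F G : {lrmorphism L -> B}) :
  (forall h, F (lgen h) = G (lgen h)) -> F ltheta = G ltheta ->
  F lthetaV = G lthetaV -> F =1 G.
Proof.
move=> Eg Et EtV; elim/laurent_ind => // [x y Ex Ey|x y Ex Ey|c x Ex].
- by rewrite !linearD /= Ex Ey.
- by rewrite !rmorphM /= Ex Ey.
- by rewrite !linearZ /= Ex.
Qed.
End Laurent.

Arguments ltheta {k} H.
Arguments lthetaV {k} H.

(* The maps H ⊗ H -> L ⊗ L and H ⊗ H ⊗ H -> L ⊗ L ⊗ L induced by H -> L. *)
Definition lgen2 (k : fieldType) (H : algType k) (t : H ⊗ H) :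
  laurent H ⊗ laurent H := \sw_(a, b <- t) (lgen a ⊗ lgen b).
Definition lgen3 (k : fieldType) (H : algType k) (t : H ⊗ H ⊗ H) :
  laurent H ⊗ laurent H ⊗ laurent H :=
  \sw_(a, b, c <- t) (lgen a ⊗ lgen b ⊗ lgen c).

(* Main.v *)
Require Import Defs.
From HB Require Import structures.
From mathcomp Require Import all_boot all_order all_algebra.
Import GRing.Theory.
Local Open Scope ring_scope.

(** The element F = R21 R of H ⊗ H is invertible and, because R intertwines Δ
    with its opposite, commutes with every Δ(h).  Hence F^-1 (θ ⊗ θ) is an
    invertible element of L ⊗ L, for L = H[θ, θ^-1], that commutes with the
    image of Δ, and the universal property of L extends Δ to it
    ([laurent_comul]); ε extends in the same way.  Balance then costs nothing:
    η = θ^-1 is central, and Δ(θ^-1) = F (θ^-1 ⊗ θ^-1) is the required identity.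

    It remains to check the quasi-bialgebra and R-matrix axioms on L.  Those
    that mention only Φ, R and the restriction of Δ to H (pentagon, both
    hexagons, the counit of Φ) are transported along H -> L by naturality.  The
    others have the form f(x) u = u g(x) for algebra morphisms f, g on L, so it
    is enough to verify them on H and on θ^-1 ([laurent_intertwine]); working
    with θ^-1 instead of θ avoids all inverses of F.  On θ^-1 they become
    identities in the tensor powers of H:

    - coassociativity becomes the equality of the two ways to write the full
      twist on three strands,
        (id ⊗ Δ)(F) F_23 Φ = Φ (Δ ⊗ id)(F) F_12   ([full_twist]).
      Moving one crossing past a coproduct on each side, by
      Δ^cop(h) R = R Δ(h), and expanding by the hexagons turns both sides into
      the same product of six crossings and five reassociators;
    - counitality becomes (id ⊗ ε)(F) = 1 = (ε ⊗ id)(F), which follows from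
      (ε ⊗ id)(R) = 1 = (id ⊗ ε)(R) ([rmx_counitl], [rmx_counitr]).  These come
      from applying ε to one leg of a hexagon, once (id ⊗ id ⊗ ε)(Φ) = 1 is
      known ([reassoc_counit3]), and that in turn comes from the pentagon;
    - Δ^cop(x) R = R Δ(x) becomes R R21 R = R R21 R.

    Everything is computed with algebra morphisms between tensor powers
    (permutations of legs, insertions of 1, Δ or ε on one leg): the sumless
    expressions in the axioms are first identified with values of such
    morphisms, after which identities of elements are rewritings in a ring and
    identities of morphisms are checked on pure tensors. *)

(** * Maps out of a tensor product *)
Section Sweedler.
Context {k : fieldType}.

Fact ten_linear {A B : lmodType k} (a : A) : linear (@ten k A B a).
Proof. by move=> c x y; rewrite tenDr tenZr. Qed.
HB.instance Definition _ (A B : lmodType k) (a : A) :=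
  GRing.isLinear.Build k _ _ *:%R (@ten k A B a) (ten_linear a).

(** A sum over a chosen decomposition of t agrees with a linear map as soon as
    the summand is the value of that map on pure tensors; the multilinearity of
    the summand need not be proved separately. *)
Lemma tliftP {A B W : lmodType k} (F : {linear (A ⊗ B)%type -> W})
    (f : A -> B -> W) t :
  (forall a b, f a b = F (a ⊗ b)) -> tlift f t = F t.
Proof.
move=> fF; rewrite [in RHS](tensor_reprE t) linear_sum.
by apply: eq_bigr => p _; rewrite fF.
Qed.

Lemma tlift3P {A B C W : lmodType k} (F : {linear (A ⊗ B ⊗ C)%type -> W})
    (f : A -> B -> C -> W) t :
  (forall a b c, f a b c = F (a ⊗ b ⊗ c)) -> tlift3 f t = F t.
Proof.
by move=> fF; apply: tliftP => a u; apply: (tliftP (F \o ten a)) => b c; rewrite fF.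
Qed.

Lemma tensor3_ind {A B C : lmodType k} (P : (A ⊗ B ⊗ C)%type -> Prop) :
  (forall a b c, P (a ⊗ b ⊗ c)) -> (forall t u, P t -> P u -> P (t + u)) ->
  forall t, P t.
Proof.
move=> Pt PD; apply: tensor_ind => // a; apply: tensor_ind => // t u.
by rewrite tenDr; exact: PD.
Qed.

Lemma tensor_ext {A B W : lmodType k}
    (F G : (A ⊗ B)%type -> W) :
    (forall a b, F (a ⊗ b) = G (a ⊗ b)) ->
  {morph F : t u / t + u} -> {morph G : t u / t + u} -> F =1 G.
Proof.
by move=> FG FD GD; elim/tensor_ind=> // t u IHt IHu; rewrite FD GD IHt IHu.
Qed.

Lemma tensor3_ext {A B C W : lmodType k}
    (F G : (A ⊗ B ⊗ C)%type -> W) :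
    (forall a b c, F (a ⊗ b ⊗ c) = G (a ⊗ b ⊗ c)) ->
  {morph F : t u / t + u} -> {morph G : t u / t + u} -> F =1 G.
Proof.
by move=> FG FD GD; apply: tensor3_ind => // t u IHt IHu; rewrite FD GD IHt IHu.
Qed.
End Sweedler.

(** * Algebra morphisms between tensor products *)
Section TensorMorphisms.
Context {k : fieldType}.
Implicit Types A B C : algType k.

Definition inl_ten {A B} (a : A) : (A ⊗ B)%type := a ⊗ 1.
Definition inr_ten {A B} (b : B) : (A ⊗ B)%type := 1 ⊗ b.

Fact inl_ten_linear A B : linear (@inl_ten A B).
Proof. by move=> c x y; rewrite /inl_ten tenDl tenZl. Qed.

Fact inl_ten_monoid A B : monoid_morphism (@inl_ten A B).
Proof. by split=> // x y; rewrite /inl_ten tenM mulr1. Qed.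

Fact inr_ten_linear A B : linear (@inr_ten A B).
Proof. by move=> c x y; rewrite /inr_ten tenDr tenZr. Qed.

Fact inr_ten_monoid A B : monoid_morphism (@inr_ten A B).
Proof. by split=> // x y; rewrite /inr_ten tenM mulr1. Qed.
HB.instance Definition _ A B :=
  GRing.isLinear.Build k A (A ⊗ B)%type *:%R inl_ten (inl_ten_linear A B).
HB.instance Definition _ A B :=
  GRing.isMonoidMorphism.Build A (A ⊗ B)%type inl_ten (inl_ten_monoid A B).
HB.instance Definition _ A B :=
  GRing.isLinear.Build k B (A ⊗ B)%type *:%R inr_ten (inr_ten_linear A B).
HB.instance Definition _ A B :=
  GRing.isMonoidMorphism.Build B (A ⊗ B)%type inr_ten (inr_ten_monoid A B).

Definition commuting {A B C} (f : A -> C) (g : B -> C) :=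
  forall a b, f a * g b = g b * f a.

(** The universal property of the tensor product of algebras.  All the
    morphisms below are instances of it, so that linearity and multiplicativity
    are proved once. *)
Definition tjoin {A B C} {f : {lrmorphism A -> C}} {g : {lrmorphism B -> C}}
  (fg : commuting f g) (t : A ⊗ B) : C := \sw_(a, b <- t) (f a * g b).

Section Tjoin.
Variables (A B C : algType k).
Variables (f : {lrmorphism A -> C}) (g : {lrmorphism B -> C}).
Hypothesis fg : commuting f g.

Let fg_bilinear : bilinear_for *:%R *:%R (fun a b => f a * g b).
Proof.
by split=> u c x y; rewrite linearP ?(mulrDl, mulrDr) -?(scalerAl, scalerAr).
Qed.

Lemma tjoinE a b : tjoin fg (a ⊗ b) = f a * g b.
Proof. exact: tliftE. Qed.

Fact tjoin_linear : linear (tjoin fg).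
Proof. exact: tlift_linear. Qed.
HB.instance Definition _ := GRing.isLinear.Build k _ _ *:%R (tjoin fg) tjoin_linear.

Fact tjoin_monoid_morphism : monoid_morphism (tjoin fg).
Proof.
have fD : {morph tjoin fg : t u / t + u} by exact: linearD.
split=> [|t u]; first by rewrite [LHS]tjoinE !rmorph1 mulr1.
elim/tensor_ind: t => [a b|t t' IH IH']; last by rewrite mulrDl !fD IH IH' mulrDl.
elim/tensor_ind: u => [a' b'|u u' IH IH']; last by rewrite mulrDr !fD IH IH' mulrDr.
by rewrite tenM !tjoinE !rmorphM -!mulrA; congr (_ * _); rewrite !mulrA fg.
Qed.
HB.instance Definition _ :=
  GRing.isMonoidMorphism.Build _ _ (tjoin fg) tjoin_monoid_morphism.
End Tjoin.

Fact tmap_comm {A A' B B'} (f : {lrmorphism A -> A'}) (g : {lrmorphism B -> B'}) :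
  commuting (inl_ten \o f : A -> A' ⊗ B')%type (inr_ten \o g).
Proof. by move=> a b; rewrite /= !tenM !mulr1 !mul1r. Qed.

Definition tmap {A A' B B'} (f : {lrmorphism A -> A'}) (g : {lrmorphism B -> B'}) :
  (A ⊗ B)%type -> (A' ⊗ B')%type := tjoin (tmap_comm f g).
HB.instance Definition _ A A' B B' f g :=
  GRing.LRMorphism.copy (@tmap A A' B B' f g) (tjoin (tmap_comm f g)).
Lemma tmapE {A A' B B'} (f : {lrmorphism A -> A'}) (g : {lrmorphism B -> B'}) a b :
  tmap f g (a ⊗ b) = f a ⊗ g b.
Proof. by rewrite [LHS]tjoinE /= tenM mulr1 mul1r. Qed.

Fact tswap_comm {A B} : commuting (@inr_ten B A) (@inl_ten B A).
Proof. by move=> a b; rewrite !tenM !mulr1 !mul1r. Qed.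

Definition tswap {A B} : (A ⊗ B)%type -> (B ⊗ A)%type := tjoin tswap_comm.
HB.instance Definition _ A B :=
  GRing.LRMorphism.copy (@tswap A B) (tjoin tswap_comm).
Lemma tswapE {A B} (a : A) (b : B) : tswap (a ⊗ b) = b ⊗ a.
Proof. by rewrite [LHS]tjoinE /= tenM mulr1 mul1r. Qed.

Fact tassoc_comm {A B C} :
  commuting (tmap idfun inl_ten : A ⊗ B -> A ⊗ B ⊗ C)%type (inr_ten \o inr_ten).
Proof.
move=> t c; elim/tensor_ind: t => [a b|t u IHt IHu].
  by rewrite tmapE /= !tenM !mulr1 !mul1r.
by rewrite linearD mulrDl mulrDr IHt IHu.
Qed.

Definition tassoc {A B C} : ((A ⊗ B) ⊗ C)%type -> (A ⊗ B ⊗ C)%type :=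
  tjoin tassoc_comm.
HB.instance Definition _ A B C :=
  GRing.LRMorphism.copy (@tassoc A B C) (tjoin tassoc_comm).
Lemma tassocE {A B C} (a : A) (b : B) (c : C) : tassoc ((a ⊗ b) ⊗ c) = a ⊗ b ⊗ c.
Proof. by rewrite [LHS]tjoinE /= tmapE /= !tenM !mulr1 !mul1r. Qed.

(** The composite of e with the unit map k -> B; a scalar commutes with
    everything, which is what lets e act on one leg by [tjoin]. *)
Definition unit_counit {A B} (e : {lrmorphism A -> k^o}) (a : A) : B := (e a : k)%:A.
Fact unit_counit_linear A B e : linear (@unit_counit A B e).
Proof. by move=> c x y; rewrite /unit_counit linearP scalerDl scalerA. Qed.

Fact unit_counit_monoid A B e : monoid_morphism (@unit_counit A B e).
Proof.
split=> [|x y]; rewrite /unit_counit ?rmorph1 ?scale1r // rmorphM.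
by rewrite mulr_algl scalerA.
Qed.
HB.instance Definition _ A B e :=
  GRing.isLinear.Build k A B *:%R (unit_counit e) (unit_counit_linear A B e).
HB.instance Definition _ A B e :=
  GRing.isMonoidMorphism.Build A B (unit_counit e) (unit_counit_monoid A B e).
Fact unit_counit_comm {A B} (e : {lrmorphism A -> k^o}) :
  commuting (unit_counit e) (@idfun B).
Proof. by move=> a b; rewrite mulr_algl mulr_algr. Qed.

Definition counit_first {A B} (e : {lrmorphism A -> k^o}) :
  (A ⊗ B)%type -> B := tjoin (unit_counit_comm e).
HB.instance Definition _ A B e :=
  GRing.LRMorphism.copy (@counit_first A B e) (tjoin (unit_counit_comm e)).
Lemma counit_firstE {A B} (e : {lrmorphism A -> k^o}) a (b : B) :
  counit_first e (a ⊗ b) = (e a : k) *: b.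
Proof. by rewrite [LHS]tjoinE /= mulr_algl. Qed.

Definition counit_second {A B} (e : {lrmorphism B -> k^o}) :
  (A ⊗ B)%type -> A := counit_first e \o tswap.
HB.instance Definition _ A B e :=
  GRing.LRMorphism.copy (@counit_second A B e) (counit_first e \o tswap).
Lemma counit_secondE {A B} (e : {lrmorphism B -> k^o}) (a : A) b :
  counit_second e (a ⊗ b) = (e b : k) *: a.
Proof. by rewrite /counit_second /= tswapE counit_firstE. Qed.

Lemma tswapK {A B} (t : (A ⊗ B)%type) : tswap (tswap t) = t.
Proof. by apply: (tensor_ext (tswap \o tswap) idfun)
  => [a b|? ?|? ?]; rewrite /= ?raddfD // !tswapE. Qed.

Lemma counit_second_swap {A B : algType k} (e : {lrmorphism A -> k^o})
  (t : (A ⊗ B)%type) : counit_second e (tswap t) = counit_first e t.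
Proof. by rewrite /counit_second /= tswapK. Qed.

Lemma counit_first_swap {A B : algType k} (e : {lrmorphism B -> k^o})
  (t : (A ⊗ B)%type) : counit_first e (tswap t) = counit_second e t.
Proof. by []. Qed.
End TensorMorphisms.
Arguments tmap {k A A' B B'} f g : simpl never.
Arguments tswap {k A B} : simpl never.
Arguments tassoc {k A B C} : simpl never.
Arguments counit_first {k A B} e : simpl never.
Arguments counit_second {k A B} e : simpl never.

(** * Operations on the legs of a triple tensor *)
Section Legs.
Context {k : fieldType}.

Definition comul_first {A B C : algType k} (D : {lrmorphism A -> (A ⊗ C)%type}) :
  (A ⊗ B -> A ⊗ C ⊗ B)%type := tassoc \o tmap D idfun.
HB.instance Definition _ A B C D :=
  GRing.LRMorphism.copy (@comul_first A B C D) (tassoc \o tmap D idfun).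
Definition comul_second {A B : algType k} (D : {lrmorphism A -> (A ⊗ A)%type}) :
  (B ⊗ A -> B ⊗ A ⊗ A)%type := tmap idfun D.
HB.instance Definition _ A B D :=
  GRing.LRMorphism.copy (@comul_second A B D) (tmap idfun D).

Implicit Type A : algType k.
Definition leg12 {A} : (A ⊗ A -> A ⊗ A ⊗ A)%type := tmap idfun inl_ten.
HB.instance Definition _ A := GRing.LRMorphism.copy (@leg12 A) (tmap idfun inl_ten).
Definition leg13 {A} : (A ⊗ A -> A ⊗ A ⊗ A)%type := tmap idfun inr_ten.
HB.instance Definition _ A := GRing.LRMorphism.copy (@leg13 A) (tmap idfun inr_ten).
Definition leg23 {A} : (A ⊗ A -> A ⊗ A ⊗ A)%type := inr_ten.
HB.instance Definition _ A := GRing.LRMorphism.copy (@leg23 A) (inr_ten).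
Definition cycl3 {A} : (A ⊗ A ⊗ A -> A ⊗ A ⊗ A)%type := tassoc \o tswap.
HB.instance Definition _ A := GRing.LRMorphism.copy (@cycl3 A) (tassoc \o tswap).
Definition cycr3 {A} : (A ⊗ A ⊗ A -> A ⊗ A ⊗ A)%type := cycl3 \o cycl3.
HB.instance Definition _ A := GRing.LRMorphism.copy (@cycr3 A) (cycl3 \o cycl3).
Definition swap23 {A} : (A ⊗ A ⊗ A -> A ⊗ A ⊗ A)%type := tmap idfun tswap.
HB.instance Definition _ A := GRing.LRMorphism.copy (@swap23 A) (tmap idfun tswap).
Definition swap12 {A} : (A ⊗ A ⊗ A -> A ⊗ A ⊗ A)%type := swap23 \o cycl3.
HB.instance Definition _ A := GRing.LRMorphism.copy (@swap12 A) (swap23 \o cycl3).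
End Legs.
Arguments comul_first {k A B C} D : simpl never.
Arguments comul_second {k A B} D : simpl never.
Arguments leg12 {k A} : simpl never.
Arguments leg13 {k A} : simpl never.
Arguments leg23 {k A} : simpl never.
Arguments cycl3 {k A} : simpl never.
Arguments cycr3 {k A} : simpl never.
Arguments swap12 {k A} : simpl never.
Arguments swap23 {k A} : simpl never.

(** * Sumless expressions as values of morphisms *)
Section SweedlerSums.
Context {k : fieldType}.
Implicit Types A B : algType k.
Lemma leg12E A (a b : A) : leg12 (a ⊗ b) = a ⊗ b ⊗ 1. Proof. exact: tmapE. Qed.

Lemma leg13E A (a b : A) : leg13 (a ⊗ b) = a ⊗ 1 ⊗ b. Proof. exact: tmapE. Qed.

Lemma leg23E A (a b : A) : leg23 (a ⊗ b) = 1 ⊗ a ⊗ b. Proof. by []. Qed.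

Lemma cycl3E A (a b c : A) : cycl3 (a ⊗ b ⊗ c) = b ⊗ c ⊗ a.
Proof. by rewrite /cycl3 /= tswapE tassocE. Qed.

Lemma cycr3E A (a b c : A) : cycr3 (a ⊗ b ⊗ c) = c ⊗ a ⊗ b.
Proof. by rewrite /cycr3 /= !cycl3E. Qed.

Lemma swap23E A (a b c : A) : swap23 (a ⊗ b ⊗ c) = a ⊗ c ⊗ b.
Proof. by rewrite [LHS]tmapE /= tswapE. Qed.

Lemma swap12E A (a b c : A) : swap12 (a ⊗ b ⊗ c) = b ⊗ a ⊗ c.
Proof. by rewrite /swap12 /= cycl3E swap23E. Qed.

Definition legE := (leg12E, leg13E, leg23E, cycl3E, cycr3E, swap12E, swap23E).

Lemma tflipE A (t : (A ⊗ A)%type) : tflip t = tswap t.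
Proof. by apply: tliftP => a b; rewrite /= tswapE. Qed.

Variable A : algType k.
Variable D : {lrmorphism A -> (A ⊗ A)%type}.
Variable e : {lrmorphism A -> k^o}.

(** A sumless expression with several bound tensors is a product of images of
    these tensors.  This lemma peels off the outermost sum: u is the part of the
    product already treated and v the part still to be treated. *)
Lemma sw_mul {X Y : lmodType k} {W : algType k}
    (F : {linear (X ⊗ Y)%type -> W}) g u v t :
  (forall a b, g a b = u * (F (a ⊗ b) * v)) -> tlift g t = u * (F t * v).
Proof.
move=> gF; rewrite [in RHS](tensor_reprE t) linear_sum mulr_suml mulr_sumr.
by apply: eq_bigr => p _; rewrite gF.
Qed.

Lemma sw_mul3 {X Y Z : lmodType k} {W : algType k}
    (F : {linear (X ⊗ Y ⊗ Z)%type -> W}) g u v t :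
  (forall a b c, g a b c = u * (F (a ⊗ b ⊗ c) * v)) -> tlift3 g t = u * (F t * v).
Proof.
move=> gF; apply: sw_mul => a b.
by apply: (sw_mul (F \o ten a)) => c d; rewrite gF.
Qed.

Lemma sw_mul3_id {X Y Z : algType k} (g : X -> Y -> Z -> (X ⊗ Y ⊗ Z)%type) u t :
  (forall a b c, g a b c = u * (a ⊗ b ⊗ c)) -> tlift3 g t = u * t.
Proof.
move=> gE; rewrite [in RHS](tensor_reprE t) mulr_sumr; apply: eq_bigr => p _.
rewrite [in RHS](tensor_reprE p.2) linear_sum mulr_sumr.
by apply: eq_bigr => q _; rewrite gE.
Qed.

Lemma sw_assoc {X Y Z : algType k} (u : X ⊗ Y) (z : Z) :
  \sw_(x, y <- u) (x ⊗ y ⊗ z) = tassoc (u ⊗ z).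
Proof.
rewrite [RHS]tjoinE -[RHS]mul1r; apply: sw_mul => x y.
by rewrite mul1r /= tmapE /= !tenM !(mul1r, mulr1).
Qed.

Lemma comul_firstE {X Y Z : algType k}
    (d : {lrmorphism X -> (X ⊗ Y)%type}) (x : X) (z : Z) :
  \sw_(x1, x2 <- d x) (x1 ⊗ x2 ⊗ z) = comul_first d (x ⊗ z).
Proof. by rewrite sw_assoc /comul_first /= tmapE. Qed.

Lemma sw_comul_first {B : algType k} (t : A ⊗ B) :
  \sw_(a, b <- t) \sw_(a1, a2 <- D a) (a1 ⊗ a2 ⊗ b) = comul_first D t.
Proof. by apply: tliftP => a b; exact: (comul_firstE D). Qed.

Lemma comul_secondE {X Y : algType k}
    (d : {lrmorphism X -> (X ⊗ X)%type}) (y : Y) x :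
  comul_second d (y ⊗ x) = y ⊗ d x.
Proof. exact: tmapE. Qed.

Lemma sw_comul_second {B : algType k} (t : B ⊗ A) :
  \sw_(a, b <- t) (a ⊗ D b) = comul_second D t.
Proof. by apply: tliftP => a b; rewrite /= comul_secondE. Qed.

Lemma sw_counit_second (t : A ⊗ A) :
  \sw_(a, b <- t) ((e b : k) *: a) = counit_second e t.
Proof. by apply: tliftP => a b; rewrite /= counit_secondE. Qed.

Lemma sw_counit_first (t : A ⊗ A) :
  \sw_(a, b <- t) ((e a : k) *: b) = counit_first e t.
Proof. by apply: tliftP => a b; rewrite /= counit_firstE. Qed.

Lemma sw_counit_middle (t : A ⊗ A ⊗ A) :
  \sw_(a, b, c <- t) ((e b : k) *: (a ⊗ c)) = tmap idfun (counit_first e) t.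
Proof. by apply: tlift3P => a b c; rewrite /= tmapE /= counit_firstE tenZr. Qed.

Lemma sw_comul_middle (t : A ⊗ A ⊗ A) :
  \sw_(a, b, c <- t) \sw_(b1, b2 <- D b) (a ⊗ b1 ⊗ b2 ⊗ c)
  = tmap idfun (comul_first D) t.
Proof.
apply: tlift3P => a b c; rewrite /= tmapE /= -comul_firstE.
rewrite -[LHS]/(\sw_(x, y <- D b) ((ten a) (x ⊗ y ⊗ c))).
by rewrite /tlift /= linear_sum.
Qed.

Lemma sw_append1 (t : A ⊗ A ⊗ A) :
  \sw_(a, b, c <- t) (a ⊗ b ⊗ c ⊗ 1) = tmap idfun leg12 t.
Proof. by apply: tlift3P => a b c; rewrite /= tmapE /= leg12E. Qed.

Lemma sw_comul_last (t : A ⊗ A ⊗ A) :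
  \sw_(a, b, c <- t) (a ⊗ b ⊗ D c) = tmap idfun (comul_second D) t.
Proof. by apply: tlift3P => a b c; rewrite /= tmapE /= comul_secondE. Qed.

Lemma sw_comul_head (t : A ⊗ A ⊗ A) :
  \sw_(a, b, c <- t) \sw_(a1, a2 <- D a) (a1 ⊗ a2 ⊗ b ⊗ c) = comul_first D t.
Proof. by apply: tlift3P => a b c; exact: (comul_firstE D). Qed.

(** Reading each bound tensor across the three legs exhibits the right-hand side
    of the first hexagon axiom, where F = Φ and G = Φ^-1, as a product in the
    triple tensor power. *)
Lemma sw_hexagonl (R : A ⊗ A) (F G : A ⊗ A ⊗ A) :
    \sw_(X1, X2, X3 <- F) \sw_(R1, R2 <- R)
    \sw_(x1, x2, x3 <- G) \sw_(r1, r2 <- R)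
    \sw_(Y1, Y2, Y3 <- F)
      (X2 * R1 * x1 * Y1 ⊗ X3 * x3 * r1 * Y2 ⊗ X1 * R2 * x2 * r2 * Y3)
  = cycl3 F * leg13 R * swap23 G * leg23 R * F.
Proof.
rewrite -!mulrA -[RHS]mul1r.
apply: sw_mul3 => X1 X2 X3; rewrite mulrA.
apply: sw_mul => R1 R2; rewrite mulrA.
apply: sw_mul3 => x1 x2 x3; rewrite mulrA.
apply: sw_mul => r1 r2; rewrite mulrA.
apply: sw_mul3_id => Y1 Y2 Y3.
by rewrite /= !legE !tenM !(mul1r, mulr1, mulrA).
Qed.

Lemma sw_hexagonr (R : A ⊗ A) (F G : A ⊗ A ⊗ A) :
    \sw_(x1, x2, x3 <- G) \sw_(R1, R2 <- R)
    \sw_(X1, X2, X3 <- F) \sw_(r1, r2 <- R)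
    \sw_(y1, y2, y3 <- G)
      (x3 * R1 * X2 * r1 * y1 ⊗ x1 * X1 * r2 * y2 ⊗ x2 * R2 * X3 * y3)
  = cycr3 G * leg13 R * swap12 F * leg12 R * G.
Proof.
rewrite -!mulrA -[RHS]mul1r.
apply: sw_mul3 => X1 X2 X3; rewrite mulrA.
apply: sw_mul => R1 R2; rewrite mulrA.
apply: sw_mul3 => x1 x2 x3; rewrite mulrA.
apply: sw_mul => r1 r2; rewrite mulrA.
apply: sw_mul3_id => Y1 Y2 Y3.
by rewrite /= !legE !tenM !(mul1r, mulr1, mulrA).
Qed.
End SweedlerSums.

(** * The full twist on three strands *)
Section FullTwist.
Context {k : fieldType} {A : algType k}.
Implicit Types (t : (A ⊗ A)%type) (u : (A ⊗ A ⊗ A)%type).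

Lemma cycl3K u : cycl3 (cycr3 u) = u.
Proof. by apply: (tensor3_ext (cycl3 \o cycr3) idfun)
  => [a b c|? ?|? ?]; rewrite /= ?raddfD // !legE. Qed.

Lemma cycr3K u : cycr3 (cycl3 u) = u.
Proof. by apply: (tensor3_ext (cycr3 \o cycl3) idfun)
  => [a b c|? ?|? ?]; rewrite /= ?raddfD // !legE. Qed.

Lemma cycl3_swap12 u : cycl3 (swap12 u) = swap23 u.
Proof. by apply: (tensor3_ext (cycl3 \o swap12) swap23)
  => [a b c|? ?|? ?]; rewrite /= ?raddfD // !legE. Qed.

Lemma cycl3_leg13 t : cycl3 (leg13 t) = leg23 (tswap t).
Proof. by apply: (tensor_ext (cycl3 \o leg13) (leg23 \o tswap))
  => [a b|? ?|? ?]; rewrite /= ?raddfD // !(legE, tswapE). Qed.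

Lemma cycl3_leg12 t : cycl3 (leg12 t) = leg13 (tswap t).
Proof. by apply: (tensor_ext (cycl3 \o leg12) (leg13 \o tswap))
  => [a b|? ?|? ?]; rewrite /= ?raddfD // !(legE, tswapE). Qed.

Lemma swap12_swap23 u : swap12 (swap23 u) = cycr3 u.
Proof. by apply: (tensor3_ext (swap12 \o swap23) cycr3)
  => [a b c|? ?|? ?]; rewrite /= ?raddfD // !legE. Qed.

Lemma swap12_leg13 t : swap12 (leg13 t) = leg23 t.
Proof. by apply: (tensor_ext (swap12 \o leg13) leg23)
  => [a b|? ?|? ?]; rewrite /= ?raddfD // !(legE, tswapE). Qed.

Lemma swap12_leg23 t : swap12 (leg23 t) = leg13 t.
Proof. by apply: (tensor_ext (swap12 \o leg23) leg13)
  => [a b|? ?|? ?]; rewrite /= ?raddfD // !(legE, tswapE). Qed.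

Lemma swap12_leg12 t : swap12 (leg12 t) = leg12 (tswap t).
Proof. by apply: (tensor_ext (swap12 \o leg12) (leg12 \o tswap))
  => [a b|? ?|? ?]; rewrite /= ?raddfD // !(legE, tswapE). Qed.

Lemma swap23_cycr3 u : swap23 (cycr3 u) = swap12 (cycl3 u).
Proof. by apply: (tensor3_ext (swap23 \o cycr3) (swap12 \o cycl3))
  => [a b c|? ?|? ?]; rewrite /= ?raddfD // !legE. Qed.

Lemma swap23_cycr3_swap23 u : swap23 (cycr3 (swap23 u)) = cycl3 u.
Proof. by apply: (tensor3_ext (swap23 \o cycr3 \o swap23) cycl3)
  => [a b c|? ?|? ?]; rewrite /= ?raddfD // !legE. Qed.

Lemma swap23_cycr3_leg13 t : swap23 (cycr3 (leg13 t)) = leg13 (tswap t).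
Proof. by apply: (tensor_ext (swap23 \o cycr3 \o leg13) (leg13 \o tswap))
  => [a b|? ?|? ?]; rewrite /= ?raddfD // !(legE, tswapE). Qed.

Lemma swap23_cycr3_leg23 t : swap23 (cycr3 (leg23 t)) = leg12 (tswap t).
Proof. by apply: (tensor_ext (swap23 \o cycr3 \o leg23) (leg12 \o tswap))
  => [a b|? ?|? ?]; rewrite /= ?raddfD // !(legE, tswapE). Qed.

Variable D : {lrmorphism A -> (A ⊗ A)%type}.

Lemma comul_first_ten a b : comul_first D (a ⊗ b) = leg12 (D a) * (1 ⊗ 1 ⊗ b).
Proof. by rewrite /comul_first /= tmapE [LHS]tjoinE. Qed.

(** Together with its mirror image below, this derives (Δ ⊗ id)(R21) from one
    hexagon and (id ⊗ Δ)(R21) from the other. *)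
Lemma comul_first_swap t : comul_first D (tswap t) = cycl3 (comul_second D t).
Proof.
apply: (tensor_ext (comul_first D \o tswap) (cycl3 \o comul_second D))
  => [a b|? ?|? ?]; rewrite /= ?raddfD //.
by rewrite tswapE comul_secondE /comul_first /cycl3 /= tmapE tswapE.
Qed.

Lemma comul_second_swap t : comul_second D (tswap t) = cycr3 (comul_first D t).
Proof. by rewrite -{2}[t]tswapK comul_first_swap cycr3K. Qed.

Variable r : (A ⊗ A)%type.
Hypothesis rD : forall a, tswap (D a) * r = r * D a.

Lemma comul_rswap a : D a * tswap r = tswap r * tswap (D a).
Proof. by rewrite -[D a in LHS]tswapK -!rmorphM rD. Qed.

(** The crossing R21 on the first two strands slides past a coproduct, which it
    turns into the opposite one. *)
Lemma comul_first_rswap t :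
  comul_first D t * leg12 (tswap r) = leg12 (tswap r) * swap12 (comul_first D t).
Proof.
elim/tensor_ind: t => [a b|t u IHt IHu].
  rewrite !comul_first_ten.
  have cZ v : (1 ⊗ 1 ⊗ b) * leg12 v = leg12 v * (1 ⊗ 1 ⊗ b) :> (A ⊗ A ⊗ A)%type.
    elim/tensor_ind: v => [x y|x y IHx IHy];
      first by rewrite leg12E !tenM !(mul1r, mulr1).
    by rewrite raddfD mulrDr IHx IHy mulrDl.
  rewrite [in RHS]rmorphM /= swap12_leg12 swap12E -mulrA cZ !mulrA; congr (_ * _).
  by rewrite -[LHS]rmorphM -[RHS]rmorphM comul_rswap.
by rewrite !raddfD /= mulrDl mulrDr IHt IHu.
Qed.

Lemma rswap_comul_second t :
  leg23 r * comul_second D t = swap23 (comul_second D t) * leg23 r.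
Proof.
elim/tensor_ind: t => [a b|t u IHt IHu].
  by rewrite comul_secondE /swap23 tmapE /= !tenM mul1r mulr1 rD.
by rewrite !raddfD /= mulrDl mulrDr IHt IHu.
Qed.

Lemma leg12_group (t : (A ⊗ A)%type) (a : A) :
  leg12 (t * (a ⊗ a)) * (1 ⊗ 1 ⊗ a) = leg12 t * (a ⊗ a ⊗ a).
Proof.
rewrite [leg12 (_ * _)]rmorphM /= -mulrA; congr (_ * _).
by rewrite leg12E !tenM !mulr1 mul1r.
Qed.

Lemma leg23_group (t : (A ⊗ A)%type) (a : A) :
  a ⊗ (t * (a ⊗ a)) = leg23 t * (a ⊗ a ⊗ a).
Proof. by rewrite tenM mul1r. Qed.

Lemma monodromy_comm a : tswap r * r * D a = D a * (tswap r * r).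
Proof. by rewrite -mulrA -rD mulrA -comul_rswap mulrA. Qed.

Lemma monodromy_comul_second t :
  leg23 (tswap r * r) * comul_second D t = comul_second D t * leg23 (tswap r * r).
Proof.
elim/tensor_ind: t => [a b|t u IHt IHu].
  by rewrite comul_secondE !tenM mul1r mulr1 monodromy_comm.
by rewrite !raddfD /= mulrDl mulrDr IHt IHu.
Qed.

Variables (Phi : (A ⊗ A ⊗ A)%type).
Hypothesis PhiU : Phi \is a GRing.unit.
Hypothesis hexl : comul_first D r
  = cycl3 Phi * leg13 r * swap23 Phi^-1 * leg23 r * Phi.
Hypothesis hexr : comul_second D r
  = cycr3 Phi^-1 * leg13 r * swap12 Phi * leg12 r * Phi^-1.

(** The two orders in which a full twist on three strands is obtained from full
    twists on two: braid (12) and then the pair with 3, or (23) and then 1 with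
    the pair. *)
Lemma full_twist : comul_second D (tswap r * r) * leg23 (tswap r * r) * Phi
  = Phi * (comul_first D (tswap r * r) * leg12 (tswap r * r)).
Proof.
(* Break the symmetry: slide R21 past (Δ ⊗ id)(R), which becomes
   (Δ^cop ⊗ id)(R). *)
have lhs : comul_first D (tswap r) * (leg12 (tswap r) * swap12 (comul_first D r))
    * leg12 r
    = comul_first D (tswap r * r) * leg12 (tswap r * r).
  by rewrite -comul_first_rswap !rmorphM /= !mulrA.
(* On the other side F_23 commutes with (id ⊗ Δ)(F), so it can be put first,
   and R_23 slides past (id ⊗ Δ)(R21). *)
have rhs : leg23 (tswap r) * (swap23 (comul_second D (tswap r)) * leg23 r)
    * comul_second D r
    = comul_second D (tswap r * r) * leg23 (tswap r * r).
  by rewrite -monodromy_comul_second -rswap_comul_second !rmorphM /= !mulrA.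
(* All four coproducts are now expanded by the hexagons, and only the outer
   reassociators remain to be cancelled. *)
rewrite -lhs -rhs comul_first_swap comul_second_swap hexl hexr !rmorphM /=.
rewrite cycr3K cycl3K cycl3_swap12 cycl3_leg13 cycl3_leg12 swap12_swap23.
rewrite swap12_leg13 swap12_leg23 swap23_cycr3_swap23 swap23_cycr3_leg13.
rewrite swap23_cycr3_leg23 swap23_cycr3.
by rewrite !mulrA divrr // mul1r mulrVK.
Qed.
End FullTwist.

(** * The counit on the reassociator and on the R-matrix *)
Section CounitLegs.
Context {k : fieldType} {A : algType k} (e : {lrmorphism A -> k^o}).
Implicit Types (t : (A ⊗ A)%type) (u : (A ⊗ A ⊗ A)%type).
Local Notation e2 := (tmap idfun (counit_first e)).
Local Notation e3 := (tmap idfun (counit_second e)).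

Let e1 : e 1 = 1 :> k. Proof. exact: rmorph1. Qed.

Lemma counit2_cycl3 u : e2 (cycl3 u) = tswap (e3 u).
Proof.
apply: (tensor3_ext (e2 \o cycl3) (tswap \o e3))
  => [a b c|? ?|? ?]; rewrite /= ?raddfD //.
by rewrite legE !tmapE /= counit_firstE counit_secondE tswapE tenZl tenZr.
Qed.

Lemma counit2_swap23 u : e2 (swap23 u) = e3 u.
Proof.
apply: (tensor3_ext (e2 \o swap23) e3)
  => [a b c|? ?|? ?]; rewrite /= ?raddfD //.
by rewrite legE !tmapE /= counit_firstE counit_secondE.
Qed.

Lemma counit2_leg13 t : e2 (leg13 t) = t.
Proof.
apply: (tensor_ext (e2 \o leg13) idfun) => [a b|? ?|? ?]; rewrite /= ?raddfD //.
by rewrite legE !tmapE /= counit_firstE e1 scale1r.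
Qed.

Lemma counit2_leg23 t : e2 (leg23 t) = inr_ten (counit_first e t).
Proof. exact: tmapE. Qed.

Lemma counit3_cycr3 u : e3 (cycr3 u) = tswap (e2 u).
Proof.
apply: (tensor3_ext (e3 \o cycr3) (tswap \o e2))
  => [a b c|? ?|? ?]; rewrite /= ?raddfD //.
by rewrite legE !tmapE /= counit_firstE counit_secondE tswapE tenZl tenZr.
Qed.

Lemma counit3_swap12 u : e3 (swap12 u) = tswap (e3 u).
Proof.
apply: (tensor3_ext (e3 \o swap12) (tswap \o e3))
  => [a b c|? ?|? ?]; rewrite /= ?raddfD //.
by rewrite legE !tmapE /= !counit_secondE tswapE tenZl tenZr.
Qed.

Lemma counit3_leg12 t : e3 (leg12 t) = t.
Proof.
apply: (tensor_ext (e3 \o leg12) idfun) => [a b|? ?|? ?]; rewrite /= ?raddfD //.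
by rewrite legE !tmapE /= counit_secondE e1 scale1r.
Qed.

Lemma counit3_leg13 t : e3 (leg13 t) = inl_ten (counit_second e t).
Proof.
apply: (tensor_ext (e3 \o leg13) (inl_ten \o counit_second e))
  => [a b|? ?|? ?]; rewrite /= ?raddfD //.
by rewrite legE !tmapE /= !counit_secondE /inl_ten tenZl tenZr.
Qed.

(** Tensoring with 1 is injective, since the counit splits it; this and its
    mirror image below are what extract (id ⊗ ε)(R) and (ε ⊗ id)(R). *)
Lemma inl_ten_eq1 {B : algType k} (b : B) : inl_ten b = 1 :> (B ⊗ A)%type -> b = 1.
Proof.
by move/(congr1 (counit_second e)); rewrite counit_secondE e1 scale1r rmorph1.
Qed.

Lemma inr_ten_eq1 {B : algType k} (b : B) : inr_ten b = 1 :> (A ⊗ B)%type -> b = 1.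
Proof.
by move/(congr1 (counit_first e)); rewrite counit_firstE e1 scale1r rmorph1.
Qed.
End CounitLegs.

Section QuasiBialgebraFacts.
Context {k : fieldType} {A : algType k} (Q : quasiBialgebra A).
Local Notation D := (comul Q).
Local Notation e := (counit Q).
Local Notation Phi := (reassoc Q).

Lemma coassoc_comul a : comul_second D (D a) * Phi = Phi * comul_first D (D a).
Proof.
rewrite -sw_comul_second comul_coassoc sw_comul_first mulrVK //; exact: reassoc_unit.
Qed.

Lemma counit_second_comul a : counit_second e (D a) = a.
Proof. by rewrite -sw_counit_second counitr. Qed.

Lemma counit_first_comul a : counit_first e (D a) = a.
Proof. by rewrite -sw_counit_first counitl. Qed.

Lemma pentagon_comul :
  inr_ten Phi * tmap idfun (comul_first D) Phi * tmap idfun leg12 Phi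
  = tmap idfun (comul_second D) Phi * comul_first D Phi.
Proof.
have := reassoc_pentagon Q.
by rewrite sw_comul_middle sw_append1 sw_comul_last sw_comul_head.
Qed.

Lemma reassoc_counit2 : tmap idfun (counit_first e) Phi = 1.
Proof. by rewrite -sw_counit_middle reassoc_counit. Qed.

Lemma counit_second_comul_second {B : algType k} (t : (B ⊗ A)%type) :
  tmap idfun (counit_second e) (comul_second D t) = t.
Proof.
apply: (tensor_ext (tmap idfun (counit_second e) \o comul_second D) idfun)
  => [a b|? ?|? ?]; rewrite /= ?raddfD //.
by rewrite comul_secondE tmapE /= counit_second_comul.
Qed.

Lemma counit_first_comul_second {B : algType k} (t : (B ⊗ A)%type) :
  tmap idfun (counit_first e) (comul_second D t) = t.
Proof.
apply: (tensor_ext (tmap idfun (counit_first e) \o comul_second D) idfun)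
  => [a b|? ?|? ?]; rewrite /= ?raddfD //.
by rewrite comul_secondE tmapE /= counit_first_comul.
Qed.

Lemma counit_first_tassoc {B C : algType k} (u : (B ⊗ A)%type) (c : C) :
  tmap idfun (counit_first e) (tassoc (u ⊗ c)) = counit_second e u ⊗ c.
Proof.
elim/tensor_ind: u => [b a|u v IHu IHv].
  by rewrite tassocE tmapE /= counit_firstE counit_secondE tenZl tenZr.
by rewrite tenDl !raddfD /= IHu IHv tenDl.
Qed.

Lemma counit_first_comul_first {B : algType k} (t : (A ⊗ B)%type) :
  tmap idfun (counit_first e) (comul_first D t) = t.
Proof.
apply: (tensor_ext (tmap idfun (counit_first e) \o comul_first D) idfun)
  => [a b|? ?|? ?]; rewrite /= ?raddfD //.
by rewrite /comul_first /= tmapE counit_first_tassoc counit_second_comul.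
Qed.

Local Notation e2 := (tmap idfun (counit_first e)).
Local Notation e3 := (tmap idfun (counit_second e)).
Local Notation G := (tmap idfun e2).

(** Apply ε to the third leg of the pentagon.  The factor 1 ⊗ Φ and the factor
    (Δ ⊗ id ⊗ id)(Φ) have ε on the middle leg of Φ and disappear, two factors
    become Φ, and what is left is Φ (X ⊗ 1) = Φ with X = (id ⊗ id ⊗ ε)(Φ). *)
Lemma reassoc_counit3 : e3 Phi = 1.
Proof.
have G1 : G (inr_ten Phi : (A ⊗ A ⊗ A ⊗ A)%type) = 1.
  by rewrite [LHS]tmapE /= reassoc_counit2.
have G2 : G (tmap idfun (comul_first D) Phi) = Phi.
  apply: (tensor_ext (tmap idfun e2 \o tmap idfun (comul_first D)) idfun)
    => [a b|? ?|? ?]; rewrite /= ?raddfD //.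
  by rewrite !tmapE /= counit_first_comul_first.
have G3 : G (tmap idfun leg12 Phi) = leg12 (e3 Phi).
  apply: (tensor3_ext (tmap idfun e2 \o tmap idfun leg12) (leg12 \o e3))
    => [a b c|? ?|? ?]; rewrite /= ?raddfD //.
  rewrite !tmapE /= leg12E tmapE /= counit_firstE counit_secondE leg12E.
  by rewrite [in RHS]tenZl [b ⊗ _ in LHS]tenZr.
have G4 : G (tmap idfun (comul_second D) Phi) = Phi.
  apply: (tensor_ext (tmap idfun e2 \o tmap idfun (comul_second D)) idfun)
    => [a b|? ?|? ?]; rewrite /= ?raddfD //.
  by rewrite !tmapE /= counit_first_comul_second.
have G5 : G (comul_first D Phi) = comul_first D (e2 Phi).
  apply: (tensor3_ext (tmap idfun e2 \o comul_first D) (comul_first D \o e2))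
    => [a b c|? ?|? ?]; rewrite /= ?raddfD //.
  rewrite tmapE /= counit_firstE /comul_first /= !tmapE /=.
  elim/tensor_ind: (D a) => [x y|x y IHx IHy].
    by rewrite !tassocE tmapE /= tmapE /= counit_firstE.
  by rewrite !tenDl !raddfD /= IHx IHy.
have := congr1 G pentagon_comul.
rewrite !rmorphM /= G1 G2 G3 G4 G5 reassoc_counit2 rmorph1 mul1r mulr1.
move/(canRL (mulKr (reassoc_unit Q))); rewrite mulVr ?reassoc_unit //.
by move/(congr1 (e3)); rewrite counit3_leg12 rmorph1.
Qed.

Variable R : quasitriangular Q.
Local Notation r := (rmx R).

Lemma rmx_comul_first : comul_first D r
  = cycl3 Phi * leg13 r * swap23 Phi^-1 * leg23 r * Phi.
Proof. by rewrite -sw_comul_first rmx_comull sw_hexagonl. Qed.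

Lemma rmx_comul_second : comul_second D r
  = cycr3 Phi^-1 * leg13 r * swap12 Phi * leg12 r * Phi^-1.
Proof. by rewrite -sw_comul_second rmx_comulr sw_hexagonr. Qed.

Lemma rmx_comm_swap a : tswap (D a) * r = r * D a.
Proof. by rewrite -tflipE rmx_comm. Qed.

(** Apply ε to the middle leg of the first hexagon: the reassociators vanish and
    R = R (1 ⊗ x) with x = (ε ⊗ id)(R). *)
Lemma rmx_counitl : counit_first e r = 1.
Proof.
have := congr1 e2 rmx_comul_first.
rewrite !rmorphM /= counit2_cycl3 counit2_leg13 counit2_swap23
  counit2_leg23 counit_first_comul_first reassoc_counit2.
rewrite rmorphV ?reassoc_unit //= reassoc_counit3 rmorph1 mul1r invr1 !mulr1.
move/esym/(canRL (mulKr (rmx_unit R))); rewrite mulVr ?rmx_unit //.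
exact: (inr_ten_eq1 e).
Qed.

(** Apply ε to the last leg of the second hexagon: the reassociators vanish and
    R = (x ⊗ 1) R with x = (id ⊗ ε)(R). *)
Lemma rmx_counitr : counit_second e r = 1.
Proof.
have := congr1 e3 rmx_comul_second.
rewrite !rmorphM /= counit3_cycr3 counit3_leg13 counit3_swap12
  counit3_leg12 counit_second_comul_second.
rewrite (rmorphV e2) ?(rmorphV e3) ?reassoc_unit //= reassoc_counit3 reassoc_counit2.
rewrite invr1 rmorph1 mul1r !mulr1.
move/esym/(canRL (mulrK (rmx_unit R))); rewrite mulrV ?rmx_unit //.
exact: (inl_ten_eq1 e).
Qed.
End QuasiBialgebraFacts.

(** * Naturality in the algebra *)
Section Naturality.
Context {k : fieldType}.

Lemma tmap_square {X X' C C' E E' : algType k}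
    (f : {lrmorphism X -> X'}) (g : {lrmorphism C -> C'}) (g' : {lrmorphism E -> E'})
    (h : {lrmorphism C -> E}) (h' : {lrmorphism C' -> E'}) (t : (X ⊗ C)%type) :
  (forall c, g' (h c) = h' (g c)) ->
  tmap idfun g' (tmap f h t) = tmap f h' (tmap idfun g t).
Proof.
move=> sq; apply: (tensor_ext (tmap idfun g' \o tmap f h) (tmap f h' \o tmap idfun g))
  => [a c|? ?|? ?]; rewrite /= ?raddfD //.
by rewrite !tmapE /= sq.
Qed.

Context {A B : algType k} (f : {lrmorphism A -> B}).
Implicit Types (t : (A ⊗ A)%type) (u : (A ⊗ A ⊗ A)%type).
Definition tmap2 : (A ⊗ A -> B ⊗ B)%type := tmap f f.
HB.instance Definition _ := GRing.LRMorphism.copy tmap2 (tmap f f).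
Definition tmap3 : (A ⊗ A ⊗ A -> B ⊗ B ⊗ B)%type := tmap f tmap2.
HB.instance Definition _ := GRing.LRMorphism.copy tmap3 (tmap f tmap2).
Lemma tmap2E a b : tmap2 (a ⊗ b) = f a ⊗ f b.
Proof. exact: tmapE. Qed.

Lemma tmap3E a b c : tmap3 (a ⊗ b ⊗ c) = f a ⊗ f b ⊗ f c.
Proof. by rewrite [LHS]tmapE /= tmap2E. Qed.

Lemma tmap2_swap t : tmap2 (tswap t) = tswap (tmap2 t).
Proof.
apply: (tensor_ext (tmap2 \o tswap) (tswap \o tmap2))
  => [a b|? ?|? ?]; rewrite /= ?raddfD //.
by rewrite !(tmap2E, tswapE).
Qed.

Lemma tmap3_leg12 t : tmap3 (leg12 t) = leg12 (tmap2 t).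
Proof.
apply: (tensor_ext (tmap3 \o leg12) (leg12 \o tmap2))
  => [a b|? ?|? ?]; rewrite /= ?raddfD //.
by rewrite tmap2E !legE tmap3E rmorph1.
Qed.

Lemma tmap3_leg13 t : tmap3 (leg13 t) = leg13 (tmap2 t).
Proof.
apply: (tensor_ext (tmap3 \o leg13) (leg13 \o tmap2))
  => [a b|? ?|? ?]; rewrite /= ?raddfD //.
by rewrite tmap2E !legE tmap3E rmorph1.
Qed.

Lemma tmap3_leg23 t : tmap3 (leg23 t) = leg23 (tmap2 t).
Proof. by rewrite [LHS]tmapE rmorph1. Qed.

Lemma tmap3_cycl3 u : tmap3 (cycl3 u) = cycl3 (tmap3 u).
Proof.
apply: (tensor3_ext (tmap3 \o cycl3) (cycl3 \o tmap3))
  => [a b c|? ?|? ?]; rewrite /= ?raddfD //.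
by rewrite !(legE, tmap3E).
Qed.

Lemma tmap3_cycr3 u : tmap3 (cycr3 u) = cycr3 (tmap3 u).
Proof.
apply: (tensor3_ext (tmap3 \o cycr3) (cycr3 \o tmap3))
  => [a b c|? ?|? ?]; rewrite /= ?raddfD //.
by rewrite !(legE, tmap3E).
Qed.

Lemma tmap3_swap12 u : tmap3 (swap12 u) = swap12 (tmap3 u).
Proof.
apply: (tensor3_ext (tmap3 \o swap12) (swap12 \o tmap3))
  => [a b c|? ?|? ?]; rewrite /= ?raddfD //.
by rewrite !(legE, tmap3E).
Qed.

Lemma tmap3_swap23 u : tmap3 (swap23 u) = swap23 (tmap3 u).
Proof.
apply: (tensor3_ext (tmap3 \o swap23) (swap23 \o tmap3))
  => [a b c|? ?|? ?]; rewrite /= ?raddfD //.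
by rewrite !(legE, tmap3E).
Qed.

Section Comul.
Variables (D : {lrmorphism A -> (A ⊗ A)%type}) (D' : {lrmorphism B -> (B ⊗ B)%type}).
Hypothesis fD : forall a, D' (f a) = tmap2 (D a).

Lemma comul_second_map {C C' : algType k}
    (g : {lrmorphism C -> C'}) (t : (C ⊗ A)%type) :
  comul_second D' (tmap g f t) = tmap g tmap2 (comul_second D t).
Proof.
apply: (tensor_ext (comul_second D' \o tmap g f) (tmap g tmap2 \o comul_second D))
  => [a b|? ?|? ?]; rewrite /= ?raddfD //.
by rewrite !(tmapE, comul_secondE) /= fD.
Qed.

Lemma comul_first_map {C C' : algType k}
    (g : {lrmorphism C -> C'}) (t : (A ⊗ C)%type) :
  comul_first D' (tmap f g t) = tmap f (tmap f g) (comul_first D t).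
Proof.
apply: (tensor_ext (comul_first D' \o tmap f g) (tmap f (tmap f g) \o comul_first D))
  => [a c|? ?|? ?]; rewrite /= ?raddfD //.
rewrite tmapE /comul_first /= !tmapE /= fD.
elim/tensor_ind: (D a) => [x y|x y IHx IHy].
  by rewrite tmap2E !tassocE !tmapE /= tmapE.
by rewrite !(raddfD, tenDl) /= IHx IHy.
Qed.
End Comul.

Section Counit.
Variables (e : {lrmorphism A -> k^o}) (e' : {lrmorphism B -> k^o}).
Hypothesis fe : forall a, e' (f a) = e a.
Lemma counit_first_map {C C' : algType k}
    (g : {lrmorphism C -> C'}) (t : (A ⊗ C)%type) :
  counit_first e' (tmap f g t) = g (counit_first e t).
Proof.
apply: (tensor_ext (counit_first e' \o tmap f g) (g \o counit_first e))
  => [a b|? ?|? ?]; rewrite /= ?raddfD //.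
by rewrite tmapE !counit_firstE fe linearZ.
Qed.

Lemma counit_second_map {C C' : algType k}
    (g : {lrmorphism C -> C'}) (t : (C ⊗ A)%type) :
  counit_second e' (tmap g f t) = g (counit_second e t).
Proof.
apply: (tensor_ext (counit_second e' \o tmap g f) (g \o counit_second e))
  => [a b|? ?|? ?]; rewrite /= ?raddfD //.
by rewrite tmapE !counit_secondE fe linearZ.
Qed.
End Counit.
End Naturality.

(** * Morphisms on the Laurent polynomial algebra *)
Section LaurentGeneral.
Context {k : fieldType} {H : algType k}.
Local Notation L := (laurent H).
Local Notation gen2 := (tmap2 (@lgen k H)).
Local Notation gen3 := (tmap3 (@lgen k H)).
Local Notation theta := (ltheta H).
Local Notation thetaV := (lthetaV H).

Lemma lgen2E (t : (H ⊗ H)%type) : lgen2 t = gen2 t.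
Proof. by apply: tliftP => a b; rewrite /= tmap2E. Qed.

Lemma lgen3E (t : (H ⊗ H ⊗ H)%type) : lgen3 t = gen3 t.
Proof. by apply: tlift3P => a b c; rewrite /= tmap3E. Qed.

Lemma lgen_thetaVC h : lgen h * thetaV = thetaV * lgen h.
Proof.
by rewrite -[LHS]mul1r -lthetaVK -mulrA (mulrA theta) -lgen_thetaC
  -mulrA lthetaK mulr1.
Qed.

(** The elements on which F(x) u = u G(x) form a subalgebra, and it contains θ
    as soon as it contains θ^-1. *)
Lemma laurent_intertwine {B : algType k} (F G : {lrmorphism L -> B}) (u : B) :
    (forall h, F (lgen h) * u = u * G (lgen h)) -> F thetaV * u = u * G thetaV ->
  forall x, F x * u = u * G x.
Proof.
move=> Eg EV; apply: laurent_ind => //.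
- rewrite -[LHS]mulr1 -(rmorph1 G) -lthetaVK rmorphM /= mulrA -(mulrA (F theta)).
  by rewrite -EV mulrA -rmorphM lthetaK rmorph1 mul1r.
- by move=> x y Ex Ey; rewrite !raddfD /= mulrDl Ex Ey mulrDr.
- by move=> x y Ex Ey; rewrite !rmorphM /= -mulrA Ey mulrA Ex mulrA.
- by move=> c x Ex; rewrite !linearZ /= -scalerAl Ex scalerAr.
Qed.

Lemma lthetaV_central x : thetaV * x = x * thetaV.
Proof.
by symmetry; apply: (@laurent_intertwine _ idfun idfun) => // h; exact: lgen_thetaVC.
Qed.

Lemma gen2_commute (c : L) (t : (H ⊗ H)%type) :
    (forall h, lgen h * c = c * lgen h) ->
  gen2 t * (c ⊗ c) = (c ⊗ c) * gen2 t.
Proof.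
move=> cC; elim/tensor_ind: t => [a b|t u IHt IHu].
  by rewrite tmap2E !tenM !cC.
by rewrite raddfD /= mulrDl mulrDr IHt IHu.
Qed.

Lemma gen3_commute (c : L) (t : (H ⊗ H ⊗ H)%type) :
    (forall h, lgen h * c = c * lgen h) ->
  gen3 t * (c ⊗ c ⊗ c) = (c ⊗ c ⊗ c) * gen3 t.
Proof.
move=> cC; elim/(@tensor3_ind k): t => [a b d|t u IHt IHu].
  by rewrite tmap3E !tenM !cC.
by rewrite raddfD /= mulrDl mulrDr IHt IHu.
Qed.

Lemma laurent_comul (D : {lrmorphism H -> (H ⊗ H)%type}) (F : (H ⊗ H)%type) :
    F \is a GRing.unit -> (forall h, F * D h = D h * F) ->
  exists DL : {lrmorphism L -> (L ⊗ L)%type},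
    [/\ forall h, DL (lgen h) = gen2 (D h),
        DL theta = gen2 F^-1 * (theta ⊗ theta)
      & DL thetaV = gen2 F * (thetaV ⊗ thetaV)].
Proof.
move=> FU FD.
have thC := gen2_commute _ _ (@lgen_thetaC k H).
have thVC := gen2_commute _ _ lgen_thetaVC.
apply: (@laurent_universal _ _ _ (gen2 \o D)) => [h /=||].
- rewrite mulrA -rmorphM (commrV (esym (FD h))) rmorphM /= -!mulrA; congr (_ * _).
  exact: thC.
- rewrite mulrA -(mulrA (gen2 _)) -thC mulrA -rmorphM mulVr // rmorph1 mul1r.
  by rewrite tenM lthetaK.
- rewrite mulrA -(mulrA (gen2 _)) -thVC mulrA -rmorphM mulrV // rmorph1 mul1r.
  by rewrite tenM lthetaVK.
Qed.

Lemma laurent_counit (e : {lrmorphism H -> k^o}) :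
  exists eL : {lrmorphism L -> k^o},
    [/\ forall h, eL (lgen h) = e h, eL theta = 1 & eL thetaV = 1].
Proof.
apply: laurent_universal => [h||]; by rewrite ?mulr1 ?mul1r.
Qed.

End LaurentGeneral.

(** * The axioms on the Laurent polynomial algebra *)
Section LaurentQuasitriangular.
Context {k : fieldType} {H : algType k} (Q : quasiBialgebra H)
  (R : quasitriangular Q).
Local Notation L := (laurent H).
Local Notation gen2 := (tmap2 (@lgen k H)).
Local Notation gen3 := (tmap3 (@lgen k H)).
Local Notation theta := (ltheta H).
Local Notation thetaV := (lthetaV H).
Local Notation Phi := (reassoc Q).
Local Notation r := (rmx R).
Local Notation F := (tswap r * r).

Variables (D : {lrmorphism L -> (L ⊗ L)%type}) (e : {lrmorphism L -> k^o}).
Hypotheses (Dgen : forall h, D (lgen h) = gen2 (comul Q h))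
  (DthetaV : D thetaV = gen2 F * (thetaV ⊗ thetaV)).
Hypotheses (egen : forall h, e (lgen h) = counit Q h) (ethetaV : e thetaV = 1).

(** On θ^-1 both sides are the image of an element of H ⊗ H ⊗ H times the
    triple tensor power of θ^-1, and the elements are those of [full_twist]. *)
Lemma laurent_coassoc x :
  comul_second D (D x) * gen3 Phi = gen3 Phi * comul_first D (D x).
Proof.
apply: (@laurent_intertwine _ _ _ (comul_second D \o D) (comul_first D \o D))
  => [h|] /=.
  by rewrite Dgen (comul_second_map _ _ _ Dgen) (comul_first_map _ _ _ Dgen)
    -!rmorphM coassoc_comul.
have Dr : comul_second D (D thetaV)
    = gen3 (comul_second (comul Q) F * leg23 F) * (thetaV ⊗ thetaV ⊗ thetaV).
  rewrite DthetaV rmorphM /= (comul_second_map _ _ _ Dgen) comul_secondE DthetaV.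
  by rewrite [in RHS](rmorphM gen3) /= tmap3_leg23 -mulrA; congr (_ * _);
    exact: leg23_group.
have Dl : comul_first D (D thetaV)
    = gen3 (comul_first (comul Q) F * leg12 F) * (thetaV ⊗ thetaV ⊗ thetaV).
  rewrite DthetaV rmorphM /= (comul_first_map _ _ _ Dgen) comul_first_ten DthetaV.
  rewrite [in RHS](rmorphM gen3) /= tmap3_leg12 -!mulrA; congr (_ * _).
  exact: leg12_group.
rewrite Dr Dl -mulrA -gen3_commute; last exact: lgen_thetaVC.
rewrite !mulrA -!rmorphM; congr (gen3 _ * _).
apply: full_twist.
- exact: rmx_comm_swap.
- exact: reassoc_unit.
- exact: rmx_comul_first.
- exact: rmx_comul_second.
Qed.

Lemma laurent_counitr x : counit_second e (D x) = x.
Proof.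
suff: (counit_second e \o D) x * 1 = 1 * idfun x by rewrite mulr1 mul1r.
apply: laurent_intertwine => [h|]; rewrite mulr1 mul1r /=.
  by rewrite Dgen (counit_second_map _ _ _ egen) counit_second_comul.
rewrite DthetaV rmorphM /= (counit_second_map _ _ _ egen) counit_secondE
  ethetaV scale1r.
by rewrite (rmorphM (counit_second _)) /= counit_second_swap
  rmx_counitr rmx_counitl mulr1 rmorph1 mul1r.
Qed.

Lemma laurent_counitl x : counit_first e (D x) = x.
Proof.
suff: (counit_first e \o D) x * 1 = 1 * idfun x by rewrite mulr1 mul1r.
apply: laurent_intertwine => [h|]; rewrite mulr1 mul1r /=.
  by rewrite Dgen (counit_first_map _ _ _ egen) counit_first_comul.
rewrite DthetaV rmorphM /= (counit_first_map _ _ _ egen) counit_firstE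
  ethetaV scale1r.
by rewrite (rmorphM (counit_first _)) /= counit_first_swap
  rmx_counitr rmx_counitl mulr1 rmorph1 mul1r.
Qed.

(** On θ^-1 this says that the flip of F satisfies F_21 R = R F; both are
    R R21 R. *)
Lemma laurent_rmx_comm x : tflip (D x) * gen2 r = gen2 r * D x.
Proof.
rewrite tflipE; apply: (@laurent_intertwine _ _ _ (tswap \o D) D) => [h|] /=.
  by rewrite Dgen -tmap2_swap -!rmorphM rmx_comm_swap.
rewrite DthetaV (rmorphM tswap) /= tswapE -mulrA -gen2_commute; last exact: lgen_thetaVC.
rewrite !mulrA -tmap2_swap -!rmorphM /=; congr (gen2 _ * _).
by rewrite (rmorphM tswap) /= tswapK mulrA.
Qed.

Local Notation P := (gen3 Phi).
Lemma laurent_pentagon :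
  inr_ten P * tmap idfun (comul_first D) P * tmap idfun leg12 P
  = tmap idfun (comul_second D) P * comul_first D P.
Proof.
pose gen4 := tmap (@lgen k H) gen3.
have p1 : inr_ten P = gen4 (inr_ten Phi).
  by rewrite [RHS]tmapE rmorph1.
have p2 : tmap idfun (comul_first D) P
    = gen4 (tmap idfun (comul_first (comul Q)) Phi).
  by apply: tmap_square => t; exact: comul_first_map.
have p3 : tmap idfun leg12 P = gen4 (tmap idfun leg12 Phi).
  by apply: tmap_square => t; rewrite /= tmap3_leg12.
have p4 : tmap idfun (comul_second D) P
    = gen4 (tmap idfun (comul_second (comul Q)) Phi).
  by apply: tmap_square => t; exact: comul_second_map.
have p5 : comul_first D P = gen4 (comul_first (comul Q) Phi).
  exact: comul_first_map.
by rewrite p1 p2 p3 p4 p5 -!(rmorphM gen4) pentagon_comul.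
Qed.

Lemma laurent_rmx_comul_first :
  comul_first D (gen2 r) = cycl3 (gen3 Phi) * leg13 (gen2 r)
    * swap23 (gen3 Phi)^-1 * leg23 (gen2 r) * gen3 Phi.
Proof.
rewrite (comul_first_map _ _ _ Dgen) -(rmorphV gen3) ?reassoc_unit //.
rewrite -tmap3_cycl3 -tmap3_leg13 -tmap3_swap23 -tmap3_leg23 -!(rmorphM gen3).
by rewrite rmx_comul_first.
Qed.

Lemma laurent_rmx_comul_second :
  comul_second D (gen2 r) = cycr3 (gen3 Phi)^-1 * leg13 (gen2 r)
    * swap12 (gen3 Phi) * leg12 (gen2 r) * (gen3 Phi)^-1.
Proof.
rewrite (comul_second_map _ _ _ Dgen) -(rmorphV gen3) ?reassoc_unit //.
rewrite -tmap3_cycr3 -tmap3_leg13 -tmap3_swap12 -tmap3_leg12 -!(rmorphM gen3).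
by rewrite rmx_comul_second.
Qed.

Lemma laurent_reassoc_counit2 : tmap idfun (counit_first e) (gen3 Phi) = 1.
Proof.
rewrite (@tmap_square _ _ _ _ _ _ _ _ (counit_first (counit Q)) _ _ (@lgen k H)).
  by rewrite reassoc_counit2 rmorph1.
by move=> t; exact: counit_first_map.
Qed.
End LaurentQuasitriangular.

Theorem proposition4p3 (k : fieldType) (H : algType k)
    (Q : quasiBialgebra H) (R : quasitriangular Q) :
  exists (QL : quasiBialgebra (laurent H)) (RL : quasitriangular QL),
    [/\ reassoc QL = lgen3 (reassoc Q),
        rmx RL = lgen2 (rmx R)
      & balanced RL] /\
    [/\ forall h : H, comul QL (lgen h) = lgen2 (comul Q h),
        comul QL (ltheta H)
          = (tflip (rmx RL) * rmx RL)^-1 * (ltheta H ⊗ ltheta H)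
      & comul QL (lthetaV H)
          = (tflip (rmx RL) * rmx RL) * (lthetaV H ⊗ lthetaV H)] /\
    [/\ forall h : H, counit QL (lgen h) = counit Q h,
        counit QL (ltheta H) = 1
      & counit QL (lthetaV H) = 1].
Proof.
have FU : tswap (rmx R) * rmx R \is a GRing.unit.
  by rewrite unitrMr ?rmorph_unit ?rmx_unit.
have [D [Dgen Dth DthV]] :=
  laurent_comul _ _ FU (monodromy_comm _ _ (rmx_comm_swap _ R)).
have [e [egen eth ethV]] := laurent_counit (counit Q).
pose P := tmap3 (@lgen k H) (reassoc Q).
have PU : P \is a GRing.unit by rewrite rmorph_unit // reassoc_unit.
have coas x : \sw_(a, b <- D x) (a ⊗ D b)
   = P * (\sw_(a, b <- D x) \sw_(a1, a2 <- D a) (a1 ⊗ a2 ⊗ b)) * P^-1.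
  rewrite sw_comul_second sw_comul_first; apply: (canRL (mulrK PU)).
  exact: (laurent_coassoc _ _ _ Dgen DthV).
have cr x : \sw_(a, b <- D x) ((e b : k) *: a) = x.
  by rewrite sw_counit_second; exact: (laurent_counitr _ _ _ _ Dgen DthV egen ethV).
have cl x : \sw_(a, b <- D x) ((e a : k) *: b) = x.
  by rewrite sw_counit_first; exact: (laurent_counitl _ _ _ _ Dgen DthV egen ethV).
have pent := laurent_pentagon _ _ Dgen.
rewrite -sw_comul_middle -sw_append1 -sw_comul_last -sw_comul_head in pent.
have rc := laurent_reassoc_counit2 _ _ egen; rewrite -sw_counit_middle in rc.
pose QL := QuasiBialgebra PU coas cr cl pent rc.
have RU : tmap2 (@lgen k H) (rmx R) \is a GRing.unit.
  by rewrite rmorph_unit // rmx_unit.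
have hl := laurent_rmx_comul_first _ R _ Dgen;
rewrite -sw_comul_first -sw_hexagonl in hl.
have hr := laurent_rmx_comul_second _ R _ Dgen;
rewrite -sw_comul_second -sw_hexagonr in hr.
pose RL := @Quasitriangular k _ QL _ RU hl hr (laurent_rmx_comm _ _ _ Dgen DthV).
have FE : tflip (tmap2 (@lgen k H) (rmx R)) * tmap2 (@lgen k H) (rmx R)
    = tmap2 (@lgen k H) (tswap (rmx R) * rmx R).
  by rewrite tflipE rmorphM /= tmap2_swap.
exists QL, RL; split; first split.
- by rewrite lgen3E.
- by rewrite lgen2E.
- exists (lthetaV H); split=> [|x|].
  + by exists (ltheta H); rewrite lthetaVK lthetaK.
  + exact: lthetaV_central.
  + by rewrite /= FE DthV gen2_commute //; exact: lgen_thetaVC.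
split; split=> [h||] //=.
- by rewrite Dgen lgen2E.
- by rewrite FE Dth rmorphV.
- by rewrite FE.
Qed.
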